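(* 1. Up to isomorphism there are exactly four extensible graphs $(\Lambda,Y)$ with parameter $t=1$; their parameters $(t,s,\bar s)$ are $(1,1,0)$, $(1,2,2)$, $(1,3,4)$, $(1,5,8)$ (one graph for each). 2. For each of them let $\Gamma$ be a simple graph on $X=Y\cup\{x\}$ ($x\notin Y$) with $\Gamma^x=\Lambda$, and for a vertex $y\in Y$ let $(\Lambda_2,Y_2)$ be the graph induced by $\Lambda$ on $Y_2=\Lambda(y,2)$. Then: (a) If $(t,s,\bar s)=(1,1,0)$: $|Y|=3$, $|X|=4$, $\Lambda$ is a triangle, $\mathrm{Aut}(\Lambda)\cong\mathcal{S}_3$ and $G(\Gamma)\cong\mathcal{S}_4$. (b) If $(t,s,\bar s)=(1,2,2)$: $|Y|=9$, $|X|=10$; $\mathrm{Aut}(\Lambda_2,Y_2)$ is permutation-isomorphic to the symmetry group of a square acting on its vertices (order $8$); $\mathrm{Aut}(\Lambda,Y)$ is transitive on $Y$ and has order $72$; $G(\Gamma)$ is doubly transitive on $X$ and has order $720$. (c) If $(t,s,\bar s)=(1,3,4)$: $|Y|=15$, $|X|=16$; $\mathrm{Aut}(\Lambda_2,Y_2)$ is permutation-isomorphic to the symmetry group of a cube acting on its vertices (order $48$); $\mathrm{Aut}(\Lambda,Y)$ is transitive on $Y$ and has order $720$; $G(\Gamma)$ is doubly transitive on $X$ and has order $11520$. (d) If $(t,s,\bar s)=(1,5,8)$: $|Y|=27$, $|X|=28$; $\mathrm{Aut}(\Lambda_2,Y_2)$ is permutation-isomorphic to the automorphism group of the graph formed by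 the $4$-dimensional hypercube together with its main diagonals, of order $2^4\cdot 5!=1920$; $\mathrm{Aut}(\Lambda,Y)$ is transitive on $Y$ and has order $51840$; $G(\Gamma)$ is doubly transitive on $X$, has order $1451520$, and is permutation-isomorphic to the degree-$28$ doubly transitive representation of the simple group $S_6(2)=PSp_6(2)$.
   Context: A finite simple graph $(\Lambda,Y)$ is called extensible with parameters $(t,s,\bar s)$ (nonnegative integers) if: (1) $\Lambda$ has diameter at most $2$; (2) for every $y\in Y$, writing $\Lambda(y,d)$ for the set of vertices at distance $d$ from $y$: (a) $|\Lambda(y,1)|=2s$; (b) $|\Lambda(y,2)|=2\bar s$; (c) every $z\in\Lambda(y,1)$ is adjacent to exactly $\bar s$ points of $\Lambda(y,2)$ and to exactly $t=2s-\bar s-1$ points of $\Lambda(y,1)$; (d) every $z\in\Lambda(y,2)$ is adjacent to exactly $s$ points of $\Lambda(y,2)$ and to exactly $s$ points of $\Lambda(y,1)$; (3) every edge lies in exactly $t$ triangles; (4) $|Y|=1+2s+2\bar s$. For a simple graph $\Gamma$ on a finite set $X$, its matrix $\mathcal{E}=(\varepsilon_{i,j})$ has $\varepsilon_{i,j}=-1$ if $i\ne j$ are adjacent, $1$ otherwise. Graphs on $X$ with matrices $\mathcal{E},\mathcal{E}'$ are associated if $\varepsilon'_{i,j}=\nu_i\nu_j\varepsilon_{i,j}$ for some $\nu_i\in\{\pm1\}$. $G(\Gamma)$ is the group of permutations $\sigma$ of $X$ such that $\Gamma$ and its image ${}^\sigma\Gamma$ are associated. ${}^x\Gamma$ is the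 unique graph associated to $\Gamma$ in which $x$ is isolated; $\Gamma^x$ is the graph induced by ${}^x\Gamma$ on $X\setminus\{x\}$. *)

(* Defs.v *)
From mathcomp Require Import all_boot all_order all_algebra all_fingroup.
Set Implicit Arguments.
Unset Strict Implicit.
Unset Printing Implicit Defensive.

Definition simple_graph (T : finType) (e : rel T) : Prop :=
  (forall x, ~~ e x x) /\ (forall x y, e x y = e y x).

Definition nbhd (T : finType) (e : rel T) (y : T) : {set T} := [set z | e y z].

Definition dist2 (T : finType) (e : rel T) (y : T) : {set T} :=
  [set z | [&& z != y, ~~ e y z & [exists w, e y w && e w z]]].

Definition extensible (T : finType) (e : rel T) (t s sbar : nat) : Prop :=
  [/\ simple_graph e /\
      (* t = 2s - sbar - 1 (as integers) *)
      t + sbar + 1 = 2 * s,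
      (forall y z : T, y = z \/ e y z \/ exists w, e y w && e w z),
      (forall y : T,
        [/\ #|nbhd e y| = 2 * s,
            #|dist2 e y| = 2 * sbar,
            (forall z, z \in nbhd e y ->
               #|nbhd e z :&: dist2 e y| = sbar /\ #|nbhd e z :&: nbhd e y| = t) &
            (forall z, z \in dist2 e y ->
               #|nbhd e z :&: dist2 e y| = s /\ #|nbhd e z :&: nbhd e y| = s)]),
      (forall y z : T, e y z -> #|nbhd e y :&: nbhd e z| = t) &
      #|T| = 1 + 2 * s + 2 * sbar].

Definition graph_iso (T1 T2 : finType) (e1 : rel T1) (e2 : rel T2) : Prop :=
  exists f : T1 -> T2, bijective f /\ forall a b, e2 (f a) (f b) = e1 a b.

Definition graphAut (T : finType) (e : rel T) : {set {perm T}} :=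
  [set s : {perm T} | [forall a, [forall b, e (s a) (s b) == e a b]]].

Definition induced (T : finType) (e : rel T) (A : {set T}) : rel {z : T | z \in A} :=
  fun a b => e (val a) (val b).
Arguments induced {T} e A.

Definition eps (X : finType) (g : rel X) (i j : X) : int :=
  if (i != j) && g i j then (-1)%R else 1%R.

Definition sgn (b : bool) : int := if b then (-1)%R else 1%R.

Definition associated (X : finType) (g g' : rel X) : bool :=
  [exists nu : {ffun X -> bool}, [forall i, [forall j,
     eps g' i j == (sgn (nu i) * sgn (nu j) * eps g i j)%R]]].

Definition img_graph (X : finType) (s : {perm X}) (g : rel X) : rel X :=
  fun i j => g ((s^-1)%g i) ((s^-1)%g j).

Definition Ggrp (X : finType) (g : rel X) : {set {perm X}} :=
  [set s : {perm X} | associated g (img_graph s g)].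

(* Gamma^x = Lambda, where X = option T and x = None :
   the graph ^x Gamma associated to Gamma in which x is isolated
   induces Lambda on Y = T *)
Definition Gamma_x_is (T : finType) (g : rel (option T)) (lam : rel T) : Prop :=
  exists g' : rel (option T),
    [/\ associated g g', (forall z, ~~ g' None z) &
        (forall y z : T, g' (Some y) (Some z) = lam y z)].

Definition transitive_on (T : finType) (A : {set {perm T}}) : Prop :=
  forall a b : T, exists2 s, s \in A & s a = b.

Definition doubly_transitive (T : finType) (A : {set {perm T}}) : Prop :=
  forall a b c d : T, a != b -> c != d ->
    exists2 s, s \in A & s a = c /\ s b = d.

Definition perm_iso (S U : finType) (A : {set {perm S}}) (B : {set {perm U}}) : Prop :=
  exists f : S -> U, [/\ bijective f,
    (forall s, s \in A -> exists2 t, t \in B & forall a, f (s a) = t (f a)) &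
    (forall t, t \in B -> exists2 s, s \in A & forall a, f (s a) = t (f a))].

Definition hamming (n : nat) (u v : {ffun 'I_n -> bool}) : nat :=
  #|[set i | u i != v i]|.

Definition cube_graph (n : nat) : rel {ffun 'I_n -> bool} :=
  fun u v => hamming u v == 1.
Arguments cube_graph n : clear implicits.

Definition cube4_diag : rel {ffun 'I_4 -> bool} :=
  fun u v => (hamming u v == 1) || (hamming u v == 4).

Definition V6 := {ffun 'I_6 -> bool}.

Definition vadd (u v : V6) : V6 := [ffun i => u i (+) v i].

Definition o6 (k : nat) : 'I_6 := inord k.

Definition symp (u v : V6) : bool :=
  (u (o6 0) && v (o6 1)) (+) (u (o6 1) && v (o6 0)) (+)
  (u (o6 2) && v (o6 3)) (+) (u (o6 3) && v (o6 2)) (+)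
  (u (o6 4) && v (o6 5)) (+) (u (o6 5) && v (o6 4)).

(* Sp_6(2) = S_6(2) = PSp_6(2): linear maps preserving symp *)
Definition Sp62 : {set {perm V6}} :=
  [set g : {perm V6} | [forall u, [forall v,
     (g (vadd u v) == vadd (g u) (g v)) && (symp (g u) (g v) == symp u v)]]].

(* quadratic forms of minus type (elliptic) polarizing to symp *)
Definition minus_form (Q : {ffun V6 -> bool}) : bool :=
  [forall u, [forall v, Q (vadd u v) == Q u (+) Q v (+) symp u v]] &&
  (#|[set v | Q v]| == 36).

Definition Omega28 := {Q : {ffun V6 -> bool} | minus_form Q}.

Definition form_act (g : {perm V6}) (Q : {ffun V6 -> bool}) : {ffun V6 -> bool} :=
  [ffun v => Q ((g^-1)%g v)].

Definition Sp62_on28 : {set {perm Omega28}} :=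
  [set t : {perm Omega28} |
     [exists g in Sp62, [forall q, val (t q) == form_act g (val q)]]].

(* Main.v *)
Require Import Defs.
From mathcomp Require Import all_boot all_order all_algebra all_fingroup.
From Stdlib Require PeanoNat.
From mathcomp Require Import zify.
Set Implicit Arguments.
Unset Strict Implicit.
Unset Printing Implicit Defensive.

(** For t = 1 the triangles of the graph are lines of size 3, and the graph is the
    collinearity graph of a generalized quadrangle with s lines on each point.

    Fix points y, z at distance 2 and order their common neighbours as a_0, ..., a_(s-1).
    Each point x at distance 2 from y is adjacent to exactly one point, besides y, of each
    line y a_i; sliding x along the line through that point gives involutions on the
    points at distance 2 from y. They commute, so F_2^s acts on these 4(s-1) points,
    and the pattern of adjacencies to the a_i shows that the stabilizer of z is contained
    in {0, (1,...,1)}. Comparing 2^s with 4(s-1) leaves s = 2, 3, 5, with trivial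
    stabilizer for s = 2, 3 and stabilizer of order 2 for s = 5. Thus the whole graph is
    determined by the frame (y, z, (a_i)): two graphs with the same s are isomorphic by a
    unique map matching given frames. This yields uniqueness, transitivity and
    |Aut| = |Y| (4s-4) s!, and the graph at distance 2 is the Cayley graph of the orbit.

    The map exchanging the apex with y and, on each line through y, the two other points,
    fixing everything else, is a switching automorphism. Hence G(Gamma) is transitive and
    its point stabilizer is Aut(Lambda).

    For s = 5 the 28 points are the vectors p of F_2^6 with h(p) = 1, where
    h = x0 x1 + x2 x3 + x4 x5, or equivalently the elliptic forms h + <p, .>; the two-graph
    is the sum of <.,.> over triples. A switching automorphism sigma extends to the
    symplectic map sending p + q to sigma(p) + sigma(q). *)

(** * Lines and frames *)

Section Lines.
Variables (T : finType) (e : rel T) (s sbar : nat).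
Hypothesis ext : extensible e 1 s sbar.

Lemma ext_irr x : e x x = false.
Proof. by case: ext => [[[H _] _] _ _ _ _]; apply/negbTE. Qed.

Lemma ext_sym x y : e x y = e y x.
Proof. by case: ext => [[[_ H] _] _ _ _ _]. Qed.

Lemma ext_adj_neq x y : e x y -> x != y.
Proof. by apply: contraTneq => ->; rewrite ext_irr. Qed.

Lemma ext_sbar : sbar + 2 = 2 * s.
Proof. by case: ext => [[_ H] _ _ _ _]; lia. Qed.

Lemma ext_card : #|T| + 3 = 6 * s.
Proof. by case: ext => [[_ H] _ _ _ ->]; lia. Qed.

Lemma ext_dist2E y z : (z \in dist2 e y) = (z != y) && ~~ e y z.
Proof.
rewrite inE; case: eqP => //= nzy; case: (boolP (e y z)) => //= nyz.
apply/existsP; case: ext => [_ /(_ y z) H _ _ _].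
by case: H => [H|[H|H //]]; [case: nzy | rewrite H in nyz].
Qed.

Lemma ext_card_dist2 y : #|dist2 e y| = 4 * s - 4.
Proof. by case: ext => [_ _ /(_ y) [_ -> _ _] _ _]; have := ext_sbar; lia. Qed.

Lemma ext_card_nbhd y : #|nbhd e y| = 2 * s.
Proof. by case: ext => [_ _ /(_ y) [-> _ _ _] _ _]. Qed.

Lemma ext_mu y z : z \in dist2 e y ->
  #|nbhd e z :&: dist2 e y| = s /\ #|nbhd e z :&: nbhd e y| = s.
Proof. by case: ext => [_ _ /(_ y) [_ _ _ H] _ _]; apply: H. Qed.

(** As t = 1, adjacent [x] and [y] lie in a single triangle, and this is its third vertex. The value
    is meaningful for adjacent arguments only. *)
Definition third (x y : T) : T := odflt x [pick w | e x w && e y w].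

Lemma third_unique x y : e x y ->
  [/\ e x (third x y), e y (third x y) &
      forall w, e x w -> e y w -> w = third x y].
Proof.
move=> exy.
have /eqP/cards1P[w0 Hw0] : #|nbhd e x :&: nbhd e y| = 1.
  by case: ext => [_ _ _ /(_ x y exy) -> _].
have memw w : (e x w && e y w) = (w == w0).
  by have := in_set1 w w0; rewrite -Hw0 !inE.
rewrite /third; case: pickP => [w /=|/(_ w0)]; last by rewrite memw eqxx.
move=> Hw; have /andP[H1 H2] := Hw; split => // w' H3 H4.
by apply/eqP; move: Hw; rewrite memw => /eqP ->; rewrite -memw H3 H4.
Qed.

Lemma third_l x y : e x y -> e x (third x y).
Proof. by case/third_unique. Qed.

Lemma third_r x y : e x y -> e y (third x y).
Proof. by case/third_unique. Qed.

Lemma third_eq x y w : e x y -> e x w -> e y w -> w = third x y.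
Proof. by case/third_unique => _ _; apply. Qed.

Lemma thirdC x y : e x y -> third x y = third y x.
Proof.
move=> exy; apply: third_eq; [by rewrite ext_sym | exact: third_r | exact: third_l].
Qed.

Lemma thirdK x y : e x y -> third x (third x y) = y.
Proof.
move=> exy; apply/esym/third_eq => //; first exact: third_l.
by rewrite ext_sym third_r.
Qed.

Lemma third_thirdl x p : e x p -> third (third x p) p = x.
Proof.
move=> exp; apply/esym/third_eq; rewrite ext_sym ?third_l //.
exact: third_r.
Qed.

(* The s common neighbours of p and x meet each of the s lines on x at most
   once, hence exactly once: this is the generalized quadrangle axiom. *)
Lemma quadrangle x a p : e x a -> p != x -> ~~ e p x ->
  e p (third x a) = ~~ e p a.
Proof.
move=> exa npx nepx.
have atmost b : e x b -> e p b -> e p (third x b) -> False.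
  move=> exb epb ept; have := third_r exb => ebt.
  have : p = third b (third x b) by apply: third_eq; rewrite // ext_sym.
  have -> : third b (third x b) = x.
    by apply/esym/third_eq => //; rewrite ext_sym ?third_l.
  by move/eqP; rewrite (negbTE npx).
have Dp : p \in dist2 e x by rewrite ext_dist2E npx ext_sym.
have [_ cA] := ext_mu Dp.
set A := nbhd e p :&: nbhd e x in cA.
have inA b : (b \in A) = e p b && e x b by rewrite !inE.
have injt : {in A &, injective (third x)}.
  move=> b c; rewrite !inA => /andP[_ xb] /andP[_ xc] E.
  by rewrite -(thirdK xb) E thirdK.
have disj : A :&: third x @: A = set0.
  apply/setP => c; rewrite in_setI [RHS]inE; apply/negP => /andP[Ac /imsetP[b Ab E]].
  move: Ab Ac; rewrite !inA E => /andP[pb xb] /andP[pt _]; exact: (atmost b).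
have cU : #|A :|: third x @: A| = 2 * s.
  by rewrite cardsU disj cards0 card_in_imset // cA; lia.
have UE : A :|: third x @: A = nbhd e x.
  apply/eqP; rewrite eqEcard cU ext_card_nbhd leqnn andbT.
  apply/subsetP => c; rewrite in_setU inA inE => /orP[/andP[] //|/imsetP[b]].
  by rewrite inA => /andP[_ xb] ->; apply: third_l.
case: (boolP (e p a)) => [pa|npa] /=.
  by apply/negbTE/negP => /(atmost a exa pa).
have : a \in A :|: third x @: A by rewrite UE inE.
rewrite in_setU inA (negbTE npa) /= => /imsetP[b].
by rewrite inA => /andP[pb xb] ->; rewrite thirdK.
Qed.

End Lines.

Section Frames.
Variables (T : finType) (e : rel T) (s sbar : nat).
Hypothesis ext : extensible e 1 s sbar.

Local Notation third := (third e).
Local Notation adjC := (ext_sym ext).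
Local Notation vec := {ffun 'I_s -> bool}.

(** Points at distance 2 have exactly [s] common neighbours, so an injective [a] lists all of them,
    one on each line through [y]. *)
Definition is_frame (y z : T) (a : 'I_s -> T) :=
  [/\ z \in dist2 e y, injective a & forall i, e y (a i) && e z (a i)].

Lemma exists_frame y z : z \in dist2 e y -> exists a, is_frame y z a.
Proof.
move=> Dz; have [_ c] := ext_mu ext Dz.
set A := nbhd e z :&: nbhd e y in c.
exists (fun i => enum_val (cast_ord (esym c) i)).
split=> // [i j /enum_val_inj /cast_ord_inj // | i].
by have := enum_valP (cast_ord (esym c) i); rewrite !inE andbC.
Qed.

(** By [ext_dist2E] this is membership in [dist2 e y], freed of the existential over paths. *)
Definition far y x := (x != y) && ~~ e y x.

Section Frame.
Variables (y z : T) (a : 'I_s -> T).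
Hypothesis fr : is_frame y z a.

Local Notation C := (far y).

Lemma frame_Cz : C z.
Proof. by case: fr => H _ _; rewrite (ext_dist2E ext) in H. Qed.

Lemma frame_ya i : e y (a i).
Proof. by case: fr => _ _ /(_ i) /andP[]. Qed.

Lemma frame_za i : e z (a i).
Proof. by case: fr => _ _ /(_ i) /andP[]. Qed.

Definition opp i := third y (a i).

Lemma frame_yopp i : e y (opp i).
Proof. exact: third_l ext _ _ (frame_ya i). Qed.

Lemma C_opp x i : C x -> e x (opp i) = ~~ e x (a i).
Proof.
case/andP=> nxy nyx; apply: (quadrangle ext) => //; first exact: frame_ya.
by rewrite adjC.
Qed.

(** By the quadrangle axiom [z] is adjacent to [u] or to the third point of the line [y u]; that
    point is a common neighbour of [y] and [z], hence some [a i]. *)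
Lemma frame_cover u : e y u -> exists i, u = a i \/ u = opp i.
Proof.
move=> yu; case: fr => Dz inja fra.
have [_ c] := ext_mu ext Dz.
have cov w : e y w -> e z w -> exists i, w = a i.
  move=> yw zw; have : w \in a @: setT.
    have -> : a @: setT = nbhd e z :&: nbhd e y.
      apply/eqP; rewrite eqEcard c card_imset // cardsT card_ord leqnn andbT.
      by apply/subsetP => x /imsetP[i _ ->]; rewrite !inE andbC.
    by rewrite !inE yw zw.
  by case/imsetP => i _ ->; exists i.
have /andP[nzy nyz] := frame_Cz.
case: (boolP (e z u)) => zu; first by have [i ->] := cov u yu zu; exists i; left.
have zt : e z (third y u) by rewrite (quadrangle ext) // adjC.
have [i ti] := cov _ (third_l ext yu) zt.
by exists i; right; rewrite /opp -ti (thirdK ext).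
Qed.

(** For [x] in [C], the unique neighbour of [x] on the line [y (a i)], by [C_opp]. *)
Definition proj i x := if e x (a i) then a i else opp i.

Definition slide i x := third x (proj i x).

Lemma proj_y i x : e y (proj i x).
Proof. by rewrite /proj; case: ifP => _; [apply: frame_ya | apply: frame_yopp]. Qed.

Lemma proj_adj i x : C x -> e x (proj i x).
Proof. by move=> Cx; rewrite /proj; case: ifP => // H; rewrite C_opp // H. Qed.

Lemma C_slide i x : C x -> C (slide i x).
Proof.
move=> Cx; have /andP[nxy nyx] := Cx; apply/andP; split.
  apply: contraNneq nyx => <-; rewrite adjC; exact: third_l ext _ _ (proj_adj i Cx).
rewrite (quadrangle ext) ?proj_y //; [exact: proj_adj | by rewrite eq_sym].
Qed.

Lemma code_slide_same i x : C x -> e (slide i x) (a i) = e x (a i).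
Proof.
move=> Cx; have := third_r ext (proj_adj i Cx); rewrite adjC -/(slide i x) /proj.
by case: ifP => // _; rewrite C_opp ?C_slide // => /negbTE.
Qed.

Lemma proj_slide i x : C x -> proj i (slide i x) = proj i x.
Proof. by move=> Cx; rewrite /proj code_slide_same. Qed.

Lemma slideK i x : C x -> slide i (slide i x) = x.
Proof.
by move=> Cx; rewrite {1}/slide proj_slide // (third_thirdl ext) // proj_adj.
Qed.

Lemma adj_slide i x : C x -> e x (slide i x).
Proof. by move=> Cx; apply: third_l ext _ _ (proj_adj i Cx). Qed.

(** The point [a j] is not adjacent to [proj i x], since the two lie on different lines through [y].
    The quadrangle axiom then makes [a j] adjacent to exactly one of the other two points [x] and
    [slide i x] of the line. *)
Lemma code_slide_other i j x : i != j -> C x -> e (slide i x) (a j) = ~~ e x (a j).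
Proof.
move=> nij Cx; have xp := proj_adj i Cx.
have := quadrangle ext (x := proj i x) (a := x) (p := a j).
rewrite adjC -(thirdC ext xp) [e (a j) x]adjC [X in _ -> _ -> _ -> X = _]adjC; apply=> //.
  rewrite /proj; case: ifP => _; first by case: fr => _ inja _; rewrite (inj_eq inja) eq_sym.
  by apply/eqP => E; have := C_opp i frame_Cz; rewrite -E !frame_za.
apply/negP => ap.
have := third_eq ext (proj_y i x) (frame_ya j); rewrite adjC ap => /(_ isT).
have := third_eq ext (proj_y i x).
rewrite /proj; case: ifP => _ _ E.
  by have := C_opp i frame_Cz; rewrite /opp -E !frame_za.
case: fr => _ inja _; move/eqP: nij; apply; apply: inja.
by rewrite E /opp (thirdK ext) ?frame_ya.
Qed.

Lemma code_slide i j x : C x -> e (slide i x) (a j) = e x (a j) (+) (i != j).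
Proof.
move=> Cx; case: eqP => [<-|/eqP n] /=; first by rewrite code_slide_same // addbF.
by rewrite code_slide_other // addbT.
Qed.

(** The apex [y] is adjacent to neither [x] nor [w], hence to the third point of their line; so that
    line is one along which [x] slides. *)
Lemma C_adj x w : C x -> C w -> e x w -> exists i, w = slide i x.
Proof.
move=> Cx Cw xw; have /andP[nxy nyx] := Cx; have /andP[nwy nyw] := Cw.
have yu : e y (third x w) by rewrite (quadrangle ext) // eq_sym.
have [i Hi] := frame_cover yu; exists i.
have xu := third_l ext xw.
suff E : proj i x = third x w by rewrite /slide E (thirdK ext).
case: Hi => E; rewrite /proj E in xu *; first by rewrite xu.
by move: xu; rewrite C_opp // => /negbTE ->.
Qed.

(* A triangle inside C is impossible: every line meets the neighbourhood of y. *)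
Lemma slide_no_triangle i j x : C x -> ~~ e (slide i x) (slide j x).
Proof.
move=> Cx; apply/negP => H.
have E : slide j x = third x (slide i x) by apply: (third_eq ext); rewrite ?adj_slide.
have /andP[_] := C_slide j Cx.
by rewrite E {1}/slide (thirdK ext) ?proj_y // proj_adj.
Qed.

Lemma slide_inj i j x : C x -> i != j -> slide i x != slide j x.
Proof.
move=> Cx nij; apply/eqP => E.
have := code_slide i i Cx; rewrite E code_slide // eqxx eq_sym nij.
by case: (e x (a i)).
Qed.

(** The point [xj] is adjacent neither to [xi], as [C] has no triangle, nor to [proj j xi], as
    sliding along [j] changes the neighbour on no line but the others. By the quadrangle axiom [xj]
    is adjacent to [slide j xi], which is therefore a slide of [xj]; adjacency to [a i] identifies
    its direction. *)
Lemma slideC i j x : C x -> slide j (slide i x) = slide i (slide j x).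
Proof.
move=> Cx; have [->//|nij] := eqVneq i j.
have Ci := C_slide i Cx; have Cj := C_slide j Cx.
set xi := slide i x in Ci *; set xj := slide j x in Cj *.
have Cij := C_slide j Ci.
have xip := proj_adj j Ci.
have adjij : e xj (slide j xi).
  have E := quadrangle ext (x := proj j xi) (a := xi) (p := xj).
  rewrite /slide (thirdC ext xip) E ?slide_no_triangle //; first by rewrite adjC.
    by apply: contraTneq (proj_y j xi) => <-; case/andP: Cj.
  rewrite /proj code_slide_other //; case: ifP => /= H; last first.
    by rewrite C_opp // code_slide_same // (negbFE H).
  by rewrite code_slide_same.
have [k Ek] := C_adj Cj Cij adjij.
suff -> : i = k by [].
apply/eqP/negPn/negP => nik.
have := code_slide k i Cj; rewrite -Ek !code_slide // eqxx [j == i]eq_sym [k == i]eq_sym nij nik.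
by case: (e x (a i)).
Qed.

(** Completes squares inside [C]: the fourth vertex is determined by the other three, which drives
    [frame_fixed_dist2]. *)
Lemma common_slide i j w x : i != j -> C x -> C w ->
  e (slide i x) w -> e (slide j x) w -> w = x \/ w = slide j (slide i x).
Proof.
move=> nij Cx Cw iw jw; have Ci := C_slide i Cx; have Cj := C_slide j Cx.
have [k Ek] := C_adj Ci Cw iw; have [l El] := C_adj Cj Cw jw.
have [Eki|nki] := eqVneq k i; first by left; rewrite Ek Eki slideK.
have [Elj|nlj] := eqVneq l j; first by left; rewrite El Elj slideK.
right; suff -> : j = k by [].
apply/eqP/negPn/negP => njk.
have := code_slide k j Ci; rewrite -Ek {1}El !code_slide // eqxx nlj nij [k == j]eq_sym njk.
by case: (e x (a j)).
Qed.

(** * The action of F_2^s by slides *)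

Definition vadd2 (v w : vec) : vec := [ffun i => v i (+) w i].
Definition unitv (i : 'I_s) : vec := [ffun j => i == j].

Definition slide_seq (v : vec) (r : seq 'I_s) x :=
  foldr (fun i x => if v i then slide i x else x) x r.
Definition slides v x := slide_seq v (enum 'I_s) x.

Lemma C_slide_seq v r x : C x -> C (slide_seq v r x).
Proof. by move=> Cx; elim: r => //= i r IH; case: ifP => // _; apply: C_slide. Qed.

Lemma C_slides v x : C x -> C (slides v x).
Proof. exact: C_slide_seq. Qed.

Lemma slide_seq_slide v r i x : C x -> uniq r ->
  slide_seq (vadd2 v (unitv i)) r x =
  if i \in r then slide i (slide_seq v r x) else slide_seq v r x.
Proof.
move=> Cx; elim: r => //= j r IH /andP[njr ur].
rewrite (IH ur) !ffunE inE; have [E|nij] := eqVneq i j.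
  rewrite /= E (negbTE njr); case: (v j) => //=.
  by rewrite slideK // C_slide_seq.
rewrite addbF /=; case: (v j); case: ifP => // ir.
by rewrite slideC // C_slide_seq.
Qed.

Lemma slides_slide v i x : C x -> slides (vadd2 v (unitv i)) x = slide i (slides v x).
Proof. by move=> Cx; rewrite /slides slide_seq_slide // ?enum_uniq // mem_enum. Qed.

Lemma slides_add v w x : C x -> slides w (slides v x) = slides (vadd2 v w) x.
Proof.
move=> Cx.
(* The restriction of [w] to the indices in [r], so that induction on [r] adds one unit vector at a
   time. *)
pose wr (r : seq 'I_s) : vec := [ffun i => w i && (i \in r)].
have H r : uniq r -> slide_seq w r (slides v x) = slides (vadd2 v (wr r)) x.
  elim: r => /= [|j r IH].
    by move=> _; congr (slides _ x); apply/ffunP => i; rewrite !ffunE andbF addbF.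
  move=> /andP[njr ur]; rewrite (IH ur); case: ifP => wj.
    rewrite -slides_slide //; congr (slides _ x); apply/ffunP => i; rewrite !ffunE inE.
    rewrite -addbA; congr (_ (+) _); rewrite [j == i]eq_sym.
    by case: eqP => [->|_] /=; rewrite ?addbF // wj (negbTE njr).
  congr (slides _ x); apply/ffunP => i; rewrite !ffunE inE.
  by case: eqP => //= ->; rewrite wj.
rewrite {1}/slides H ?enum_uniq //; congr (slides _ x); apply/ffunP => i.
by rewrite !ffunE mem_enum andbT.
Qed.

Lemma slides0 x : slides [ffun=> false] x = x.
Proof. by rewrite /slides; elim: (enum _) => //= i r ->; rewrite ffunE. Qed.

Definition par (v : vec) := odd #|[set j | v j]|.

(** Each slide in a direction other than [i] flips adjacency to [a i]. The number of these in [v]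
    has parity [par v (+) v i]. *)
Lemma code_slides v i x : C x -> e (slides v x) (a i) = e x (a i) (+) (par v (+) v i).
Proof.
move=> Cx.
have H r : e (slide_seq v r x) (a i) = e x (a i) (+) odd (count (fun j => v j && (j != i)) r).
  elim: r => [|j r IH] /=; first by rewrite addbF.
  rewrite oddD; case: (v j) => /=; last by rewrite IH.
  rewrite code_slide ?C_slide_seq // IH -!addbA oddb; congr (_ (+) _); exact: addbC.
rewrite /slides H; congr (_ (+) _).
rewrite /par (cardsD1 i) inE oddD oddb addbAC addbb addFb -size_filter cardE.
congr (odd _).
by rewrite /(enum (mem _)) enumT; congr (size _); apply: eq_filter => j; rewrite !inE andbC.
Qed.

Definition ones : vec := [ffun=> true].

Lemma vadd2C (v w : vec) : vadd2 v w = vadd2 w v.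
Proof. by apply/ffunP => i; rewrite !ffunE addbC. Qed.

Lemma par_ones v : par (vadd2 v ones) = par v (+) odd s.
Proof.
rewrite /par; have -> : odd s = odd #|'I_s| by rewrite card_ord.
rewrite -(cardsC [set j | v j]) oddD addbA addbb addFb.
by congr (odd #|pred_of_set _|); apply/setP => j; rewrite !inE !ffunE addbT.
Qed.

(** Equal images have equal adjacencies to all [a i], so [par v (+) v i = par w (+) w i] for every
    [i]. Equal parities give [v = w]; different ones give complementary vectors, whose parities
    differ only when [s] is odd. *)
Lemma slides_inj_ones v w x : C x -> slides v x = slides w x ->
  v = w \/ odd s /\ w = vadd2 v ones.
Proof.
move=> Cx E.
have H i : par v (+) v i = par w (+) w i.
  by have := code_slides v i Cx; rewrite E code_slides // => /addbI.
have [Epar|npar] := eqVneq (par v) (par w).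
  by left; apply/ffunP => i; have := H i; rewrite Epar => /addbI.
have Ew : w = vadd2 v ones.
  apply/ffunP => i; rewrite !ffunE; move: npar (H i).
  by case: (par v); case: (par w); case: (v i); case: (w i).
right; split=> //; move: npar; rewrite Ew par_ones.
by case: (odd s) => //; rewrite addbF eqxx.
Qed.


(** * Counting orbits: the values of s and the stabilizers *)

Lemma frame_s_gt1 : 1 < s.
Proof.
case: fr => Dz _ _; have : 0 < #|dist2 e y| by apply/card_gt0P; exists z.
by rewrite (ext_card_dist2 ext); lia.
Qed.

Let i0 : 'I_s := Ordinal (ltnW frame_s_gt1).

(** The extra bit separates [v] from its complement, the only other vector that can have the same
    image. *)
Let slides_bit (v : vec) := (slides v z, v i0).

Lemma slides_bit_inj : injective slides_bit.
Proof.
move=> v w [/(slides_inj_ones frame_Cz)[//|[_ ->]]]; rewrite !ffunE.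
by case: (v i0).
Qed.

Lemma slides_bit_sub : slides_bit @: setT \subset setX (dist2 e y) setT.
Proof.
apply/subsetP => p /imsetP[v _ ->]; rewrite in_setX in_setT andbT (ext_dist2E ext).
exact: (C_slides v frame_Cz).
Qed.

Lemma slides_sub : (fun v => slides v z) @: setT \subset dist2 e y.
Proof.
apply/subsetP => p /imsetP[v _ ->]; rewrite (ext_dist2E ext).
exact: (C_slides v frame_Cz).
Qed.

Lemma card_vec : #|[set: vec]| = 2 ^ s.
Proof. by rewrite cardsT card_ffun card_bool card_ord. Qed.

(** The orbit of [z] lies among [4 * s - 4] points. Fibres of size at most 2 give
    [2 ^ s <= 8 * s - 8], which fails from 6 on; for even [s] the fibres are trivial and
    [2 ^ s <= 4 * s - 4] excludes 4. *)
Lemma frame_params : s \in [:: 2; 3; 5].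
Proof.
have s1 := frame_s_gt1.
have B1 : 2 ^ s <= (4 * s - 4) * 2.
  have := subset_leq_card slides_bit_sub.
  by rewrite card_imset ?card_vec ?cardsX ?(ext_card_dist2 ext) ?cardsT ?card_bool //;
     apply: slides_bit_inj.
have B2 : ~~ odd s -> 2 ^ s <= 4 * s - 4.
  move=> ns; have := subset_leq_card slides_sub.
  rewrite card_imset ?card_vec ?(ext_card_dist2 ext) // => v w.
  by case/(slides_inj_ones frame_Cz) => // -[os]; rewrite os in ns.
have [s6|] := ltnP 5 s; last first.
  have key n : 1 < n -> (~~ odd n -> 2 ^ n <= 4 * n - 4) -> n <= 5 -> n \in [:: 2; 3; 5].
    by case: n => [|[|[|[|[|[|n]]]]]] // _ /(_ isT).
  exact: key.
have H n : 8 * (n + 6) < 2 ^ (n + 6).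
  by elim: n => // n IH; rewrite addSn expnS; move: IH; lia.
by have := H (s - 6); rewrite subnK //; move: B1; lia.
Qed.

(** If the three slides composed to the identity at [x], sliding along two directions would equal
    sliding along the third, and [C] would contain a triangle. *)
Lemma slides_ones3 x : s = 3 -> C x -> slides ones x != x.
Proof.
move=> s3 Cx; apply/eqP => H.
have h0 : 0 < s by rewrite s3.
have h1 : 1 < s by rewrite s3.
have h2 : 2 < s by rewrite s3.
pose j0 := Ordinal h0; pose j1 := Ordinal h1; pose j2 := Ordinal h2.
have E : ones = vadd2 (vadd2 (vadd2 [ffun=> false] (unitv j0)) (unitv j1)) (unitv j2).
  apply/ffunP => -[[|[|[|m]]] Hm]; rewrite !ffunE //.
  by exfalso; rewrite s3 in Hm.
rewrite E !slides_slide // slides0 in H.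
have H2 : slide j1 (slide j0 x) = slide j2 x.
  by rewrite -[in RHS]H slideK // !C_slide.
have := slide_no_triangle j0 j2 Cx.
by rewrite -H2 adj_slide // C_slide.
Qed.

(** There are 32 vectors and only 16 points, so two vectors agree at [x]. They are complementary, so
    [ones] fixes a point of the orbit of [x], and by commutativity [x] itself. *)
Lemma slides_ones5 x : s = 5 -> C x -> slides ones x = x.
Proof.
move=> s5 Cx.
have /existsP[v /existsP[w /andP[nvw /eqP E]]] :
    [exists v : vec, exists w : vec, (v != w) && (slides v x == slides w x)].
  apply: contraT => /existsPn H.
  have inj : injective (fun v => slides v x).
    move=> v w E; apply/eqP/negPn/negP => nvw.
    by have /existsPn/(_ w) := H v; rewrite nvw E eqxx.
  have : #|[set slides v x | v in setT]| <= #|dist2 e y|.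
    apply/subset_leq_card/subsetP => p /imsetP[u _ ->].
    by rewrite (ext_dist2E ext); apply: (C_slides u Cx).
  by rewrite card_imset // card_vec (ext_card_dist2 ext) s5.
have [/eqP|[_ Ew]] := slides_inj_ones Cx E; first by rewrite (negbTE nvw).
rewrite Ew -slides_add // in E.
have K : x = slides v (slides v x).
  by rewrite slides_add // -[LHS]slides0; congr (slides _ x); apply/ffunP => i; rewrite !ffunE addbb.
by rewrite {1}K slides_add ?C_slides // vadd2C -slides_add ?C_slides // -E -K.
Qed.

(** Congruence modulo the stabilizer: trivial for [s] equal to 2 or 3, generated by [ones] for 5. *)
Definition eqv (v w : vec) := (v == w) || (s == 5) && (w == vadd2 v ones).

Lemma slides_eqE v w x : C x -> (slides v x == slides w x) = eqv v w.
Proof.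
move=> Cx; rewrite /eqv; apply/eqP/orP => [E|].
  have [->|[os Ew]] := slides_inj_ones Cx E; [by left | right].
  rewrite Ew eqxx andbT; move: frame_params; rewrite !inE => /or3P[] /eqP s_eq.
  - by rewrite s_eq in os.
  - by have := slides_ones3 s_eq (C_slides v Cx); rewrite slides_add // -Ew E eqxx.
  - by rewrite s_eq.
by case=> [/eqP->//|/andP[/eqP s5 /eqP ->]]; rewrite -slides_add // slides_ones5 // C_slides.
Qed.

(** The counts are tight: [2 ^ s = 4 * s - 4] for 2 and 3, and [2 ^ 5 = 2 * 16] for pairs of a point
    and a bit. *)
Lemma slides_surj w : C w -> exists v, w = slides v z.
Proof.
move=> Cw; have Dw : w \in dist2 e y by rewrite (ext_dist2E ext).
have [s5|s5] := eqVneq s 5.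
  have : (w, true) \in slides_bit @: setT.
    have -> : slides_bit @: setT = setX (dist2 e y) setT.
      apply/eqP; rewrite eqEcard slides_bit_sub cardsX (ext_card_dist2 ext) cardsT card_bool.
      by rewrite card_imset ?card_vec ?s5 //; apply: slides_bit_inj.
    by rewrite in_setX Dw inE.
  by case/imsetP => v _ [-> _]; exists v.
have : w \in (fun v => slides v z) @: setT.
  suff -> : (fun v => slides v z) @: setT = dist2 e y by [].
  apply/eqP; rewrite eqEcard slides_sub (ext_card_dist2 ext) card_imset ?card_vec.
    by move: frame_params; rewrite !inE (negbTE s5) orbF => /orP[] /eqP ->.
  by move=> v u /eqP; rewrite slides_eqE ?frame_Cz // /eqv (negbTE s5) orbF => /eqP.
by case/imsetP => v _ ->; exists v.
Qed.

Lemma slides_adjE v w :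
  e (slides v z) (slides w z) = [exists i, eqv (vadd2 v (unitv i)) w].
Proof.
have Cv := C_slides v frame_Cz; have Cw := C_slides w frame_Cz.
apply/idP/existsP => [/(C_adj Cv Cw)[i Ei]|[i]]; last first.
  by rewrite -(slides_eqE _ _ frame_Cz) slides_slide ?frame_Cz // => /eqP <-; apply: adj_slide.
by exists i; rewrite -(slides_eqE _ _ frame_Cz) slides_slide ?frame_Cz // Ei.
Qed.

(** * Coordinates for the whole graph *)

Lemma adj_a_opp i j : e (a i) (opp j) = (i == j).
Proof.
have [<-|nij] := eqVneq i j; first exact: third_r ext _ _ (frame_ya i).
apply/negP => H; move/eqP: nij; apply; case: fr => _ inja _; apply: inja.
by rewrite (third_eq ext (frame_yopp j) (frame_ya i)) ?(thirdK ext) ?frame_ya // adjC.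
Qed.

Lemma opp_z i : e z (opp i) = false.
Proof. by rewrite C_opp ?frame_Cz // frame_za. Qed.

Lemma adj_a_a i j : e (a i) (a j) = false.
Proof.
apply/negP => H; have := opp_z i.
by rewrite /opp -(third_eq ext (frame_ya i) (frame_ya j) H) frame_za.
Qed.

Lemma adj_opp_opp i j : e (opp i) (opp j) = false.
Proof.
apply/negP => H; have := third_eq ext (frame_yopp i) (frame_yopp j) H.
by rewrite (thirdK ext) ?frame_ya // => E; have := opp_z j; rewrite E frame_za.
Qed.

Lemma opp_inj : injective opp.
Proof.
move=> i j E; case: fr => _ inja _; apply: inja.
by rewrite -(thirdK ext (frame_ya i)) -/(opp i) E (thirdK ext) ?frame_ya.
Qed.

(** The left summand codes [y] and the points [a i], [opp i]; the right one codes [C] by slides of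
    [z]. For [s = 5] a point of [C] has two codes, whence [model_eq] in place of equality. *)
Definition model : finType := (option ('I_s * bool) + vec)%type.

Definition place (m : model) : T :=
  match m with
  | inl None => y
  | inl (Some (i, b)) => if b then opp i else a i
  | inr v => slides v z
  end.

Definition model_eq (m m' : model) : bool :=
  match m, m' with
  | inl p, inl q => p == q
  | inr v, inr w => eqv v w
  | _, _ => false
  end.

Definition model_adj (m m' : model) : bool :=
  match m, m' with
  | inl None, inl q => q != None
  | inl p, inl None => p != None
  | inl (Some (i, b)), inl (Some (j, c)) => (i == j) && (b != c)
  | inl None, inr _ | inr _, inl None => false
  | inl (Some (i, b)), inr v | inr v, inl (Some (i, b)) => ~~ (b (+) (par v (+) v i))
  | inr v, inr w => [exists i, eqv (vadd2 v (unitv i)) w]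
  end.

Lemma adj_slides_line v i b :
  e (slides v z) (if b then opp i else a i) = ~~ (b (+) (par v (+) v i)).
Proof.
have Cv := C_slides v frame_Cz.
by case: b; rewrite ?C_opp // code_slides ?frame_Cz // frame_za /= ?negbK // addTb.
Qed.

(** The right-hand side mentions neither the graph nor the frame, only [s]; with [place_eq] and
    [place_surj] this is what makes the graph unique. *)
Lemma place_adj m m' : e (place m) (place m') = model_adj m m'.
Proof.
have yact v : e y (slides v z) = false.
  by have /andP[_ /negbTE] := C_slides v frame_Cz.
case: m m' => [[[i b]|]|v] [[[j c]|]|w] //=.
- case: b c => [] [] /=; rewrite ?adj_opp_opp ?adj_a_a ?andbF ?andbT ?adj_a_opp //.
  by rewrite adjC adj_a_opp eq_sym.
- by case: b; rewrite adjC ?frame_ya ?frame_yopp.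
- by rewrite adjC adj_slides_line.
- by case: c; rewrite ?frame_ya ?frame_yopp.
- exact: (ext_irr ext).
- exact: adj_slides_line.
- by rewrite adjC yact.
- exact: slides_adjE.
Qed.

Lemma place_eq m m' : (place m == place m') = model_eq m m'.
Proof.
have Cv v := C_slides v frame_Cz.
have yab i b : e y (if b then opp i else a i) by case: b; rewrite ?frame_ya ?frame_yopp.
have inja : injective a by case: fr.
have nopp i j : (opp i == a j) = false.
  by apply/eqP => E; have := opp_z i; rewrite E frame_za.
case: m m' => [[[i b]|]|v] [[[j c]|]|w] //=.
- rewrite -[RHS]/((i == j) && (b == c)); case: b c => [] [];
  rewrite /= ?(inj_eq inja) ?(inj_eq opp_inj) ?andbT ?andbF ?nopp //.
  by rewrite eq_sym nopp.
- by apply/negP => /eqP E; have := yab i b; rewrite E (ext_irr ext).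
- by apply/negP => /eqP E; have /andP[_] := Cv w; rewrite -E yab.
- by apply/negP => /eqP E; have := yab j c; rewrite -E (ext_irr ext).
- by rewrite !eqxx.
- by apply/negP => /eqP E; have /andP[] := Cv w; rewrite -E eqxx.
- by apply/negP => /eqP E; have /andP[_] := Cv v; rewrite E yab.
- by apply/negP => /eqP E; have /andP[] := Cv v; rewrite E eqxx.
- by apply: slides_eqE; apply: frame_Cz.
Qed.

Lemma place_surj x : exists m, place m = x.
Proof.
have [->|nxy] := eqVneq x y; first by exists (inl None).
case: (boolP (e y x)) => [/frame_cover[i [->|->]]|nyx].
- by exists (inl (Some (i, false))).
- by exists (inl (Some (i, true))).
have Cx : C x by rewrite /far nxy nyx.
by have [v ->] := slides_surj Cx; exists (inr v).
Qed.

(** * Rigidity of frames *)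

Lemma third_fixed (h : T -> T) u w : (forall u w, e (h u) (h w) = e u w) ->
  e u w -> h u = u -> h w = w -> h (third u w) = third u w.
Proof.
move=> hE uw hu hw; apply: (third_eq ext) => //.
  by have := hE u (third u w); rewrite hu (third_l ext uw).
by have := hE w (third u w); rewrite hw (third_r ext uw).
Qed.

Lemma frame_fixed (h : T -> T) : (forall u w, e (h u) (h w) = e u w) ->
  h y = y -> h z = z -> (forall i, h (a i) = a i) -> h =1 id.
Proof.
move=> hE hy hz ha x.
have hopp i : h (opp i) = opp i by apply: third_fixed => //; apply: frame_ya.
have hmove i u : C u -> h u = u -> h (slide i u) = slide i u.
  move=> Cu hu; apply: third_fixed => //; first exact: proj_adj.
  by rewrite /proj; case: ifP.
have [m <-] := place_surj x; case: m => [[[i b]|]|v] //=; first by case: b.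
rewrite /slides; elim: (enum _) => //= i r IH; case: ifP => // _.
by rewrite hmove // C_slide_seq // frame_Cz.
Qed.

Lemma frame_fixed_dist2 (h : T -> T) :
  (forall u, C u -> C (h u)) ->
  (forall u w, C u -> C w -> h u = h w -> u = w) ->
  (forall u w, C u -> C w -> e (h u) (h w) = e u w) ->
  h z = z -> (forall i, h (slide i z) = slide i z) -> forall x, C x -> h x = x.
Proof.
move=> hC hinj hE hz hm x /slides_surj[v ->].
(* The induction must carry that all neighbours in [C] are fixed: after a slide, each new neighbour
   is the fourth vertex of a square with three fixed vertices. *)
suff [] : h (slides v z) = slides v z /\ forall i, h (slide i (slides v z)) = slide i (slides v z) by [].
rewrite /slides; elim: (enum _) => //= i r []; case: ifP => // _.
have := C_slide_seq v r frame_Cz; move: (slide_seq v r z) => u Cu hu hmu.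
split=> // j; have [->|nij] := eqVneq j i; first by rewrite slideK.
have Ci := C_slide i Cu; have Cj := C_slide j Cu; have Cij := C_slide j Ci.
have := common_slide (i := i) (j := j) (w := h (slide j (slide i u))) (x := u).
rewrite eq_sym nij => /(_ isT Cu (hC _ Cij)) H.
case: H => //.
- by rewrite -{1}hmu hE // adj_slide.
- by rewrite -{1}hmu hE // slideC // adj_slide.
move=> E; have : slide j (slide i u) = u by apply: hinj; rewrite // E hu.
move/(congr1 (slide j)); rewrite slideK // => E2.
by have := slide_inj Cu nij; rewrite E2 eqxx.
Qed.

End Frame.
End Frames.

(** * Automorphisms *)

(** Send the point with a given code in the first frame to the point with the same code in the
    second. Equality and adjacency of codes depend on [s] alone, so this is well defined and an
    isomorphism. *)
Lemma frame_iso (T1 T2 : finType) (e1 : rel T1) (e2 : rel T2) s sbar y1 z1 a1 y2 z2 a2 :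
    extensible e1 1 s sbar -> extensible e2 1 s sbar ->
    @is_frame T1 e1 s y1 z1 a1 -> @is_frame T2 e2 s y2 z2 a2 ->
  exists f : T1 -> T2,
    [/\ bijective f, forall u w, e2 (f u) (f w) = e1 u w, f y1 = y2, f z1 = z2 &
        forall i, f (a1 i) = a2 i].
Proof.
move=> ext1 ext2 fr1 fr2.
pose p1 := place e1 y1 z1 a1; pose p2 := place e2 y2 z2 a2.
pose f x := p2 (odflt (inl None) [pick m | p1 m == x]).
have fE m : f (p1 m) = p2 m.
  rewrite /f; case: pickP => [m' /=|/(_ m)]; last by rewrite eqxx.
  by rewrite (place_eq ext1 fr1) -(place_eq ext2 fr2) => /eqP.
exists f; split.
- apply: inj_card_bij; last first.
    by have := ext_card ext1; have := ext_card ext2; lia.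
  move=> u w; have [m <-] := place_surj ext1 fr1 u.
  have [m' <-] := place_surj ext1 fr1 w.
  rewrite -/p1 !fE => /eqP; rewrite (place_eq ext2 fr2) -(place_eq ext1 fr1).
  by move/eqP.
- move=> u w; have [m <-] := place_surj ext1 fr1 u.
  have [m' <-] := place_surj ext1 fr1 w.
  by rewrite -/p1 !fE (place_adj ext2 fr2) (place_adj ext1 fr1).
- exact: (fE (inl None)).
- by have := fE (inr [ffun=> false]); rewrite /p1 /p2 /= !slides0.
- by move=> i; exact: (fE (inl (Some (i, false)))).
Qed.

Lemma graphAutP (T : finType) (e : rel T) (p : {perm T}) :
  reflect (forall u w, e (p u) (p w) = e u w) (p \in graphAut e).
Proof.
rewrite inE; apply: (iffP forallP) => [H u w|H u].
  by have /forallP/(_ w)/eqP := H u.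
by apply/forallP => w; rewrite H.
Qed.

Lemma graphAut_group_set (T : finType) (e : rel T) : group_set (graphAut e).
Proof.
apply/group_setP; split; first by apply/graphAutP => u w; rewrite !perm1.
by move=> p q /graphAutP pE /graphAutP qE; apply/graphAutP => u w; rewrite !permM qE pE.
Qed.

Canonical graphAut_group (T : finType) (e : rel T) := Group (graphAut_group_set e).

Lemma graphAut_of_bij (T : finType) (e : rel T) (f : T -> T) :
  bijective f -> (forall u w, e (f u) (f w) = e u w) ->
  exists2 p, p \in graphAut e & p =1 f.
Proof.
move=> /bij_inj fI fE; exists (perm fI) => [|x]; last exact: permE.
by apply/graphAutP => u w; rewrite !permE.
Qed.

Lemma card_sigma_pred (I J : finType) (P : pred I) (Q : I -> pred J) k :
  (forall i, P i -> #|Q i| = k) -> #|[set p : I * J | P p.1 & Q p.1 p.2]| = #|P| * k.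
Proof.
move=> H; rewrite -sum1dep_card -(pair_big_dep P Q (fun _ _ => 1)) /= -sum_nat_const.
by apply: eq_bigr => i Pi; rewrite sum1_card H.
Qed.

Section Automorphisms.
Variables (T : finType) (e : rel T) (s sbar : nat).
Hypothesis ext : extensible e 1 s sbar.

Lemma exists_dist2 y : 1 < s -> exists z, z \in dist2 e y.
Proof.
move=> s1; have : 0 < #|dist2 e y| by rewrite (ext_card_dist2 ext); lia.
by case/card_gt0P => z Dz; exists z.
Qed.

Lemma graphAut_transitive : 1 < s -> transitive_on (graphAut e).
Proof.
move=> s1 y1 y2; have [z1 D1] := exists_dist2 y1 s1.
have [z2 D2] := exists_dist2 y2 s1.
have [a1 fr1] := exists_frame ext D1; have [a2 fr2] := exists_frame ext D2.
have [f [fB fE fy _ _]] := frame_iso ext ext fr1 fr2.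
by have [p pA pE] := graphAut_of_bij fB fE; exists p; rewrite ?pE.
Qed.

Lemma ext_nonempty : exists y : T, true.
Proof.
have : 0 < #|T|.
  by case: ext => [_ _ _ _ ->]; lia.
by case/card_gt0P => y _; exists y.
Qed.

Let ordering (p : T * T) (a : {ffun 'I_s -> T}) :=
  a \in [set f in ffun_on (mem (nbhd e p.2 :&: nbhd e p.1)) | injectiveb f].

Lemma card_orderings (A : {set T}) : #|A| = s ->
  #|[set f : {ffun 'I_s -> T} in ffun_on (mem A) | injectiveb f]| = s`!.
Proof. by move=> cA; rewrite card_inj_ffuns_on cA card_ord ffactnn. Qed.

(** Automorphisms act regularly on frames, by [frame_fixed] and [frame_iso]. A frame is a choice of
    [y], of [z] in [dist2 e y], and of an ordering of their [s] common neighbours. *)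
Lemma card_graphAut : 1 < s -> #|graphAut e| = #|T| * (4 * s - 4) * s`!.
Proof.
move=> s1; have [y _] := ext_nonempty; have [z Dz] := exists_dist2 y s1.
have [a fr] := exists_frame ext Dz.
pose phi (p : {perm T}) := ((p y, p z), [ffun i => p (a i)]).
have phiI : {in graphAut e &, injective phi}.
  move=> p q pA qA [Ey Ez /ffunP Ea].
  have rA : (p * q^-1)%g \in graphAut e by rewrite groupM ?groupV.
  apply/eqP; rewrite eq_mulgV1; apply/eqP/permP => x; rewrite perm1.
  apply: (frame_fixed ext fr); rewrite ?permM ?Ey ?Ez ?permK //; first exact/graphAutP.
  by move=> i; have := Ea i; rewrite !ffunE permM => ->; rewrite permK.
rewrite -(card_in_imset phiI).
have -> : phi @: graphAut e = [set p | p.1.2 \in dist2 e p.1.1 & ordering p.1 p.2].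
  apply/setP => -[[y' z'] a']; rewrite [RHS]in_set /= /ordering.
  apply/imsetP/idP => [[p /graphAutP pA [-> -> ->]]|].
    case: fr => _ inja yza; apply/andP; split.
      by move: Dz; rewrite !(ext_dist2E ext) (inj_eq perm_inj) pA.
    rewrite in_set; apply/andP; split.
      apply/ffun_onP => i; rewrite ffunE !inE !pA.
      by have /andP[-> ->] := yza i.
    by apply/injectiveP => i j; rewrite !ffunE => /perm_inj/inja.
  case/andP => D'; rewrite in_set => /andP[/ffun_onP on' /injectiveP inj'].
  have fr' : is_frame e y' z' a'.
    split=> // i; by have := on' i; rewrite !inE andbC.
  have [f [fB fE fy fz fa]] := frame_iso ext ext fr fr'.
  have [p pA pE] := graphAut_of_bij fB fE; exists p => //.
  by rewrite /phi !pE fy fz; congr (_, _); apply/ffunP => i; rewrite ffunE pE fa.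
rewrite (@card_sigma_pred _ _ [pred q : T * T | q.2 \in dist2 e q.1] ordering s`!); last first.
  move=> q /= Dq; have [_ cq] := ext_mu ext Dq; rewrite -(card_orderings cq).
  by apply: eq_card => f; rewrite !inE.
congr (_ * _).
have H := @card_sigma_pred _ _ predT (fun y => mem (dist2 e y)) (4 * s - 4)
  (fun y _ => ext_card_dist2 ext y).
apply: (etrans _ (etrans H _)); first by apply: eq_card => q; rewrite !inE.
by congr (_ * _); apply: eq_card.
Qed.

(** * The graph induced at distance 2 *)

Section Second.
Variable y : T.
Hypothesis s1 : 1 < s.
Let Y2 := dist2 e y.
Let sub2 := {x | x \in Y2}.

(** An automorphism is determined by the images of [z] and of its neighbours [slide i z]. Conversely
    any point with an ordering of its [s] neighbours at distance 2 from [y] is reached by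
    restricting an automorphism of the whole graph that fixes [y]. *)
Lemma card_graphAut_dist2 : #|graphAut (induced e Y2)| = (4 * s - 4) * s`!.
Proof.
have [z Dz] := exists_dist2 y s1; have [a fr] := exists_frame ext Dz.
have farE x : far e y x = (x \in Y2) by rewrite (ext_dist2E ext).
have Cz := frame_Cz ext fr.
have Dn i : slide e y a i z \in Y2 by rewrite -farE (C_slide ext fr).
pose zs : sub2 := Sub z Dz; pose ns i : sub2 := Sub (slide e y a i z) (Dn i).
pose phi (p : {perm sub2}) := (val (p zs), [ffun i => val (p (ns i))]).
have phiI : {in graphAut (induced e Y2) &, injective phi}.
  move=> p q pA qA [/val_inj Ez /ffunP Ea].
  have : (p * q^-1)%g \in graphAut (induced e Y2) by rewrite groupM ?groupV.
  have : (p * q^-1)%g zs = zs by rewrite permM Ez permK.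
  have : forall i, (p * q^-1)%g (ns i) = ns i.
    by move=> i; have := Ea i; rewrite !ffunE => /val_inj; rewrite permM => ->; rewrite permK.
  move: (p * q^-1)%g (eq_mulgV1 p q) => r pq rn rz /graphAutP rA.
  apply/eqP; rewrite pq; apply/eqP/permP => x; rewrite perm1.
  (* Extension by the identity, as the rigidity lemma speaks of maps on all of [T]. *)
  pose h u := if insub u is Some v then val (r v) else u.
  have hE (v : sub2) : h (val v) = val (r v) by rewrite /h valK.
  apply: val_inj; rewrite -hE.
  have sub2P u : far e y u -> exists v : sub2, u = val v.
    by rewrite farE => Du; exists (Sub u Du).
  apply: (frame_fixed_dist2 ext fr).
  - by move=> u /sub2P[v ->]; rewrite hE farE; apply: valP.
  - by move=> u w /sub2P[v ->] /sub2P[v' ->]; rewrite !hE => /val_inj/perm_inj ->.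
  - by move=> u w /sub2P[v ->] /sub2P[v' ->]; rewrite !hE; apply: rA.
  - by have := hE zs; rewrite rz.
  - by move=> i; have := hE (ns i); rewrite rn.
  - by rewrite farE; apply: valP.
rewrite -(card_in_imset phiI).
pose ord2 (z' : T) (g : {ffun 'I_s -> T}) :=
  g \in [set f in ffun_on (mem (nbhd e z' :&: Y2)) | injectiveb f].
have -> : phi @: graphAut (induced e Y2) = [set p | p.1 \in Y2 & ord2 p.1 p.2].
  apply/setP => -[z' g]; rewrite [RHS]in_set /= /ord2; apply/imsetP/idP.
    case=> p /graphAutP pA [-> ->]; rewrite (valP (p zs)) in_set /=; apply/andP; split.
      apply/ffun_onP => i; rewrite ffunE in_setI (valP (p (ns i))) andbT inE.
      have := pA zs (ns i); rewrite /induced /= => ->.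
      exact: (adj_slide ext fr).
    apply/injectiveP => i j; rewrite !ffunE => /val_inj/perm_inj/(congr1 val) /= E.
    by apply/eqP/negPn/negP => nij; have := slide_inj ext fr Cz nij; rewrite E eqxx.
  case/andP => D'; rewrite in_set => /andP[/ffun_onP on' /injectiveP inj'].
  have gz i : e z' (g i) by have := on' i; rewrite in_setI inE => /andP[].
  have gy i : g i \in Y2 by have := on' i; rewrite in_setI => /andP[].
  (* Since [y] is adjacent to neither [z'] nor [g i], it is adjacent to the third point of their
     line. *)
  have fr' : is_frame e y z' (fun i => third e z' (g i)).
    split=> [//|i j E|i].
      by apply: inj'; rewrite -(thirdK ext (gz i)) E (thirdK ext (gz j)).
    rewrite (third_l ext (gz i)) andbT.
    have /andP[nzy nyz] : far e y z' by rewrite farE.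
    rewrite (quadrangle ext) //; last by rewrite eq_sym.
    by have := gy i; rewrite -farE => /andP[].
  have [f [fB fE fy fz fa]] := frame_iso ext ext fr fr'.
  have fI := bij_inj fB.
  have fY u : u \in Y2 -> f u \in Y2.
    have := inj_eq fI u y; have := fE y u; rewrite fy => E1 E2.
    by rewrite -!farE /far E1 E2.
  pose f2 (u : sub2) : sub2 := Sub (f (val u)) (fY _ (valP u)).
  have f2I : injective f2.
    by move=> u w /(congr1 val) /= /fI/val_inj.
  exists (perm f2I).
    by apply/graphAutP => u w; rewrite /induced !permE /= fE.
  rewrite /phi !permE /= fz; congr (_, _); apply/ffunP => i; rewrite ffunE permE /=.
  have E : slide e y a i z = third e z (a i).
    by rewrite /slide /proj (frame_za fr).
  rewrite E -[LHS](thirdK ext (gz i)); apply/esym/(third_eq ext).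
  - exact: third_l ext _ _ (gz i).
  - by rewrite -fz fE (third_l ext) // (frame_za fr).
  - by rewrite -fa fE (third_r ext) // (frame_za fr).
rewrite (@card_sigma_pred _ _ (mem Y2) ord2 s`!).
  by rewrite (ext_card_dist2 ext).
move=> z' Dz'; have [cz _] := ext_mu ext Dz'; rewrite -(card_orderings cz).
by apply: eq_card => f; rewrite !inE.
Qed.

(** [F] chooses one representative vector per vertex, presenting [eU] as the Cayley graph of F_2^s
    modulo the stabilizer. *)
Lemma slides_graph_iso (U : finType) (eU : rel U) (F : U -> {ffun 'I_s -> bool}) :
  #|U| = 4 * s - 4 ->
  (forall u w, eqv (F u) (F w) -> u = w) ->
  (forall u w, eU u w = [exists i, eqv (vadd2 (F u) (unitv i)) (F w)]) ->
  exists f : U -> sub2, bijective f /\ forall u w, induced e Y2 (f u) (f w) = eU u w.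
Proof.
move=> cU Finj FE.
have [z Dz] := exists_dist2 y s1; have [a fr] := exists_frame ext Dz.
have farE x : far e y x = (x \in Y2) by rewrite (ext_dist2E ext).
have Cz := frame_Cz ext fr.
have Ds v : slides e y a v z \in Y2 by rewrite -farE (C_slides ext fr).
exists (fun u => Sub (slides e y a (F u) z) (Ds (F u))); split.
  apply: inj_card_bij => [u w /(congr1 val) /= /eqP|].
    by rewrite (slides_eqE ext fr) //; apply: Finj.
  by rewrite cU card_sig (eq_card (B := mem Y2)) ?(ext_card_dist2 ext).
by move=> u w; rewrite FE -(slides_adjE ext fr).
Qed.

End Second.
End Automorphisms.

Lemma perm_iso_graphAut (S U : finType) (eS : rel S) (eU : rel U) (f : U -> S) :
  bijective f -> (forall u w, eS (f u) (f w) = eU u w) ->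
  perm_iso (graphAut eS) (graphAut eU).
Proof.
case=> g fK gK fE; have gE a b : eU (g a) (g b) = eS a b by rewrite -fE !gK.
exists g; split; first by exists f.
  move=> p /graphAutP pE.
  have I : injective (fun u => g (p (f u))).
    by move=> u w /(can_inj gK)/perm_inj/(can_inj fK).
  exists (perm I) => [|a]; last by rewrite permE gK.
  by apply/graphAutP => u w; rewrite !permE gE pE fE.
move=> p /graphAutP pE.
have I : injective (fun a => f (p (g a))).
  by move=> u w /(can_inj fK)/perm_inj/(can_inj gK).
exists (perm I) => [|a]; last by rewrite permE fK.
by apply/graphAutP => u w; rewrite !permE fE pE gE.
Qed.

(** * Switching automorphisms of the cone *)

Section TwoGraphs.
Variable X : finType.
Implicit Types (g : rel X) (p : {perm X}).

Definition adjb g i j := (i != j) && g i j.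

(* The sum of the adjacencies over a triple is the invariant of switching. *)
Definition tri g i j k := adjb g i j (+) adjb g j k (+) adjb g i k.

Lemma sgnM a b : (sgn a * sgn b)%R = sgn (a (+) b).
Proof. by case: a b => [] []. Qed.

Lemma sgn_inj : injective sgn.
Proof. by case=> [] []. Qed.

Lemma associatedP g g' :
  reflect (exists nu : {ffun X -> bool},
             forall i j, adjb g' i j = nu i (+) nu j (+) adjb g i j)
          (associated g g').
Proof.
have epsE h i j : eps h i j = sgn (adjb h i j) by [].
apply: (iffP existsP) => -[nu H]; exists nu.
  move=> i j; have /forallP/(_ j)/eqP := forallP H i.
  by rewrite !epsE !sgnM => /sgn_inj.
by apply/forallP => i; apply/forallP => j; rewrite !epsE !sgnM H.
Qed.

Lemma associated_tri g g' i j k : associated g g' -> tri g' i j k = tri g i j k.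
Proof.
case/associatedP => nu H; rewrite /tri !H.
by case: (nu i); case: (nu j); case: (nu k); case: (adjb g i j); case: (adjb g j k);
   case: (adjb g i k).
Qed.

Lemma adjb_img p g i j : adjb (img_graph p g) i j = adjb g (p^-1%g i) (p^-1%g j).
Proof. by rewrite /adjb (inj_eq perm_inj). Qed.

Lemma GgrpP (x0 : X) g p :
  reflect (forall i j k, tri g (p i) (p j) (p k) = tri g i j k) (p \in Ggrp g).
Proof.
rewrite inE; apply: (iffP idP) => [H i j k|H].
  rewrite -(associated_tri (p i) (p j) (p k) H).
  by rewrite /tri !adjb_img !permK.
apply/associatedP.
pose q := p^-1%g.
(* Forced by the triples through [x0]: invariance of the triple of [i], [j], [x0] is exactly the
   switching equation at [i], [j]. *)
exists [ffun i => adjb g (q i) (q x0) (+) adjb g i x0] => i j.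
rewrite adjb_img !ffunE -/q; have := H (q i) (q j) (q x0); rewrite !permKV /tri.
case: (adjb g i j); case: (adjb g j x0); case: (adjb g i x0);
case: (adjb g (q i) (q j)); case: (adjb g (q j) (q x0)); by case: (adjb g (q i) (q x0)).
Qed.

Lemma Ggrp_group_set (x0 : X) g : group_set (Ggrp g).
Proof.
apply/group_setP; split; first by apply/(GgrpP x0) => i j k; rewrite !perm1.
move=> p q /(GgrpP x0) pE /(GgrpP x0) qE; apply/(GgrpP x0) => i j k.
by rewrite !permM qE pE.
Qed.

Lemma eq_Ggrp (x0 : X) g g' : (forall i j k, tri g i j k = tri g' i j k) -> Ggrp g = Ggrp g'.
Proof.
move=> E; apply/setP => p.
by apply/(GgrpP x0)/(GgrpP x0) => H i j k; [rewrite -!E | rewrite !E].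
Qed.

End TwoGraphs.

Definition cone (T : finType) (lam : rel T) : rel (option T) :=
  fun a b => match a, b with Some u, Some w => lam u w | _, _ => false end.

Lemma Ggrp_cone (T : finType) (lam : rel T) (gam : rel (option T)) :
  simple_graph gam -> Gamma_x_is gam lam -> Ggrp gam = Ggrp (cone lam).
Proof.
move=> [_ gsym] [g' [ass g'N g'E]]; apply: (eq_Ggrp None) => i j k.
rewrite -(associated_tri i j k ass).
(* The hypothesis isolates the apex in one order of arguments only; symmetry is inherited from [gam]
   through switching. *)
have g'sym a b : adjb g' a b = adjb g' b a.
  have /associatedP[nu H] := ass.
  by rewrite !H /adjb gsym eq_sym [nu a (+) _]addbC.
have E a b : adjb g' a b = adjb (cone lam) a b.
  case: a b => [a|] [b|]; rewrite /adjb /= ?g'E //.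
  - by have := g'sym (Some a) None; rewrite /adjb /= (negbTE (g'N _)).
  - by rewrite (negbTE (g'N _)).
by rewrite /tri !E.
Qed.

(** * The switching group of the cone *)

Section ConeGroup.
Variables (T : finType) (e : rel T) (s sbar : nat).
Hypothesis ext : extensible e 1 s sbar.
Let G := Ggrp (cone e).

Lemma adjb_cone u w : adjb (cone e) (Some u) (Some w) = e u w.
Proof.
rewrite /adjb /=; case: (boolP (e u w)) => [/(ext_adj_neq ext) H|]; last by rewrite andbF.
by rewrite andbT; apply: contra H => /eqP[->].
Qed.

Lemma adjb_coneN u : adjb (cone e) None u = false.
Proof. by case: u. Qed.

Lemma adjb_coneC u w : adjb (cone e) u w = adjb (cone e) w u.
Proof. by case: u w => [u|] [w|] //; rewrite !adjb_cone (ext_sym ext). Qed.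

Definition reflect_at y (u : T) := if e y u then third e y u else u.

(* Exchanging the two other points on each line through y and the apex with y
   switches the cone with respect to the neighbourhood of y. *)
Definition swap_apex y (a : option T) : option T :=
  if a is Some u then if u == y then None else Some (reflect_at y u) else Some y.

Lemma reflect_at_adj y u : e y (reflect_at y u) = e y u.
Proof. by rewrite /reflect_at; case: ifP => // H; rewrite (third_l ext). Qed.

Lemma swap_apexK y : involutive (swap_apex y).
Proof.
case=> [u|] /=; last by rewrite eqxx.
case: eqP => [->//|/eqP nuy] /=.
have E : reflect_at y (reflect_at y u) = u.
  rewrite {1}/reflect_at reflect_at_adj; case: (boolP (e y u)) => yu.
    by rewrite /reflect_at yu (thirdK ext).
  by rewrite /reflect_at (negbTE yu).
rewrite ifN ?E //; apply: contra nuy => /eqP H.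
by rewrite -E H /reflect_at (ext_irr ext).
Qed.

(** Reflecting a neighbour of [y] flips its adjacency to a far point, by the quadrangle axiom. Two
    neighbours of [y] are adjacent exactly when they are the two other points of one line, which
    reflecting both preserves. *)
Lemma reflect_at_adjE y u w : u != y -> w != y ->
  e (reflect_at y u) (reflect_at y w) = e y u (+) e y w (+) e u w.
Proof.
move=> nuy nwy; rewrite /reflect_at.
have far v x : v != y -> ~~ e y v -> e y x -> e (third e y x) v = ~~ e x v.
  move=> nvy nyv yx; rewrite ![e _ v](ext_sym ext) (quadrangle ext) //.
  by rewrite (ext_sym ext).
have near v x : e y v -> e y x -> e v x = (x == third e y v).
  move=> yv yx; apply/idP/eqP => [H|->]; last exact: (third_r ext).
  exact: (third_eq ext).
case: ifP => yu; case: ifP => yw /=.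
- rewrite (near _ _ (third_l ext yu) (third_l ext yw)) (near _ _ yu yw) (thirdK ext yu).
  apply/eqP/eqP => [<-|->]; by rewrite (thirdK ext).
- by rewrite far // yw.
- by rewrite (ext_sym ext) far // ?yu // (ext_sym ext).
- by [].
Qed.

Lemma swap_apex_G y : perm (inv_inj (swap_apexK y)) \in G.
Proof.
pose nu a := if a is Some u then e y u else false.
suff H a b : adjb (cone e) (swap_apex y a) (swap_apex y b) =
             nu a (+) nu b (+) adjb (cone e) a b.
  apply/(GgrpP None) => i j k; rewrite /tri !permE !H.
  by case: (nu i); case: (nu j); case: (nu k); case: (adjb _ i j); case: (adjb _ j k);
     case: (adjb _ i k).
have HN u : adjb (cone e) (swap_apex y None) (swap_apex y (Some u)) = e y u.
  rewrite /=; case: eqP => [->|_]; first by rewrite (ext_irr ext).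
  by rewrite adjb_cone reflect_at_adj.
case: a b => [u|] [w|].
- rewrite adjb_cone /nu /=; case: eqP => [->|/eqP nuy]; case: eqP => [->|/eqP nwy].
  + by rewrite !(ext_irr ext).
  + by rewrite adjb_coneN (ext_irr ext) /= addbb.
  + by rewrite adjb_coneC adjb_coneN (ext_irr ext) addbF [e u y](ext_sym ext) addbb.
  + by rewrite adjb_cone reflect_at_adjE.
- by rewrite adjb_coneC HN adjb_coneC adjb_coneN /= !addbF.
- by rewrite HN adjb_coneN /= addbF.
- by rewrite /adjb /= eqxx.
Qed.

Lemma G_group_set : group_set G.
Proof. exact: (Ggrp_group_set None). Qed.

Canonical G_group := Group G_group_set.

Lemma G_from_apex x : exists2 p, p \in G & p None = x.
Proof.
case: x => [y|]; last by exists 1%g; rewrite ?group1 ?perm1.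
by exists (perm (inv_inj (swap_apexK y))); rewrite ?swap_apex_G // permE.
Qed.

Lemma omap_perm_inj (p : {perm T}) : injective (omap p).
Proof. by move=> [u|] [w|] //= [/perm_inj ->]. Qed.

Definition lift_perm_apex (p : {perm T}) := perm (@omap_perm_inj p).

Lemma lift_apex_G p : p \in graphAut e -> lift_perm_apex p \in G.
Proof.
move=> /graphAutP pE; apply/(GgrpP None) => i j k.
have H a b : adjb (cone e) (lift_perm_apex p a) (lift_perm_apex p b) = adjb (cone e) a b.
  by rewrite !permE; case: a b => [a|] [b|] //=; rewrite !adjb_cone pE.
by rewrite /tri !H.
Qed.

(** On a triple through the isolated apex, [tri] is the adjacency of the other two points, so fixing
    the apex means preserving [e]. *)
Lemma G_fix_apex p : p \in G -> p None = None ->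
  exists2 q, q \in graphAut e & p = lift_perm_apex q.
Proof.
move=> /(GgrpP None) pG pN.
have pS u : exists w, p (Some u) = Some w.
  case E: (p (Some u)) => [w|]; first by exists w.
  by have := perm_inj (etrans E (esym pN)).
pose f u := odflt u (p (Some u)).
have fE u : p (Some u) = Some (f u) by rewrite /f; have [w ->] := pS u.
have fI : injective f.
  by move=> u w E; have := fE u; rewrite E -fE => /perm_inj [].
exists (perm fI).
  apply/graphAutP => u w; rewrite !permE -!adjb_cone -!fE.
  have := pG None (Some u) (Some w).
  by rewrite /tri pN !adjb_coneN !addbF.
by apply/permP => -[u|]; rewrite permE /= ?permE.
Qed.

Lemma card_G : #|G| = #|T|.+1 * #|graphAut e|.
Proof.
(* A transversal of the stabilizer of the apex: each element of [G] is uniquely a lifted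
   automorphism followed by some [tau x]. *)
pose tau x := odflt 1%g [pick p : {perm option T} | (p \in G) && (p None == x)].
have tauP x : (tau x \in G) && (tau x None == x).
  rewrite /tau; case: pickP => // H; have [p pG pN] := G_from_apex x.
  by have := H p; rewrite pG pN eqxx.
have tauG x : tau x \in G by have /andP[] := tauP x.
have tauN x : tau x None = x by have /andP[_ /eqP] := tauP x.
pose phi (q : option T * {perm T}) := (lift_perm_apex q.2 * tau q.1)%g.
have liftN p : lift_perm_apex p None = None by rewrite permE.
have phiI : injective phi.
  move=> [x p] [x' p'] E.
  have Ex : x = x' by have := congr1 (fun r : {perm _} => r None) E; rewrite !permM !liftN !tauN.
  move: E; rewrite -Ex /phi /= => /mulIg E; congr (_, _); apply/permP => u.
  by have := congr1 (fun r : {perm _} => r (Some u)) E; rewrite !permE => -[].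
have -> : G = phi @: setX setT (graphAut e).
  apply/setP => r; apply/idP/imsetP => [rG|[[x p]]]; last first.
    by rewrite in_setX => /andP[_ pA] ->; rewrite groupM // lift_apex_G.
  have rtN : (r * (tau (r None))^-1)%g None = None.
    by rewrite permM; apply: (canLR (permK _)); rewrite tauN.
  have [|q qA qE] := G_fix_apex _ rtN; first by rewrite groupM ?groupV.
  exists (r None, q); first by rewrite in_setX in_setT.
  by rewrite /phi /= -qE mulgKV.
by rewrite card_imset // cardsX cardsT card_option.
Qed.

Lemma G_doubly_transitive : transitive_on (graphAut e) -> doubly_transitive G.
Proof.
move=> tr a b c d nab ncd.
have [p pG pN] := G_from_apex a; have [q qG qN] := G_from_apex c.
have Eb : exists u, p^-1%g b = Some u.
  case E: (p^-1%g b) => [u|]; first by exists u.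
  by move: nab; rewrite -pN -E permKV eqxx.
have Ed : exists u, q^-1%g d = Some u.
  case E: (q^-1%g d) => [u|]; first by exists u.
  by move: ncd; rewrite -qN -E permKV eqxx.
have [u Eu] := Eb; have [w Ew] := Ed; have [r rA rE] := tr u w.
exists (p^-1 * lift_perm_apex r * q)%g.
  by rewrite !groupM ?groupV ?lift_apex_G.
rewrite !permM -{1}pN permK Eu !permE /= rE; split => //.
by rewrite -Ew permKV.
Qed.

End ConeGroup.

Lemma isog_perm (T U : finType) (A : {set {perm T}}) : #|T| = #|U| -> A = setT ->
  A \isog [set: {perm U}].
Proof.
move=> cTU ->.
pose f (x : T) : U := enum_val (cast_ord cTU (enum_rank x)).
pose g (x : U) : T := enum_val (cast_ord (esym cTU) (enum_rank x)).
have fK : cancel f g by move=> x; rewrite /f /g enum_valK cast_ordK enum_rankK.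
have gK : cancel g f by move=> x; rewrite /f /g enum_valK cast_ordKV enum_rankK.
have I (p : {perm T}) : injective (f \o p \o g).
  by move=> x w /(can_inj fK)/perm_inj/(can_inj gK).
pose phi p := perm (I p).
have phiM : {in setT &, {morph phi : p q / (p * q)%g}}.
  by move=> p q _ _; apply/permP => x; rewrite permM !permE /= fK permM.
apply/isogP; exists (Morphism phiM).
  apply/injmP => p q _ _ E; apply/permP => x.
  by have := congr1 (fun r : {perm U} => r (f x)) E; rewrite /= !permE /= fK => /(can_inj fK).
apply/setP => q; rewrite inE.
have J : injective (g \o q \o f).
  by move=> x w /(can_inj gK)/perm_inj/(can_inj fK).
have -> : q = phi (perm J) by apply/permP => x; rewrite !permE /= permE /= !gK.
exact: (mem_morphim (Morphism phiM)).
Qed.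

(** * Existence *)

(** The graph is strongly regular, and the remaining counts follow by splitting the neighbours of
    [z] into [y] itself, neighbours of [y], and points at distance 2 from [y]. *)
Lemma srg_extensible (T : finType) (e : rel T) (s sbar : nat) :
  simple_graph e -> sbar + 2 = 2 * s -> #|T| = 1 + 2 * s + 2 * sbar ->
  (forall y, #|nbhd e y| = 2 * s) ->
  (forall y z, y != z -> #|nbhd e y :&: nbhd e z| = if e y z then 1 else s) ->
  extensible e 1 s sbar.
Proof.
move=> [eirr esym] sb cT deg com.
have s_gt0 : 0 < s by lia.
have conn y z : y != z -> ~~ e y z -> exists w, e y w && e w z.
  move=> nyz neyz; have : 0 < #|nbhd e y :&: nbhd e z| by rewrite com // (negbTE neyz).
  by case/card_gt0P => w; rewrite !inE [e z w]esym; exists w.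
have d2E y z : (z \in dist2 e y) = (z != y) && ~~ e y z.
  rewrite inE; case: (boolP (z == y)) => //= nzy; case: (boolP (e y z)) => //= nyz.
  by apply/existsP/conn; rewrite // eq_sym.
have split3 y z : z != y ->
    #|nbhd e z| = e y z + #|nbhd e z :&: nbhd e y| + #|nbhd e z :&: dist2 e y|.
  move=> nzy; rewrite (cardsD1 y (nbhd e z)) inE [e z y]esym -addnA; congr (_ + _).
  rewrite -(cardsID (nbhd e y) (nbhd e z :\ y)); congr (_ + _); apply: eq_card => w.
    rewrite !inE; case: (w =P y) => //= ->; by rewrite (negbTE (eirr y)) andbF.
  rewrite !in_setD in_setI d2E in_set1 !inE.
  by case: (w == y); case: (e y w); case: (e z w).
split=> //.
- by split=> //; lia.
- move=> y z; have [->|nyz] := eqVneq y z; first by left.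
  by case: (boolP (e y z)) => yz; right; [left | right; apply: conn].
- move=> y; split=> //.
  + have -> : dist2 e y = ~: (y |: nbhd e y).
      by apply/setP => z; rewrite d2E !inE negb_or.
    by have := cardsC (y |: nbhd e y); rewrite cardsU1 inE (negbTE (eirr y)) deg cT; lia.
  + move=> z; rewrite inE => yz.
    have nzy : z != y by apply: contraTneq yz => ->.
    have := split3 y z nzy; rewrite deg (com z y nzy) [e z y]esym yz.
    by move=> /= H; split=> //; lia.
  + move=> z; rewrite d2E => /andP[nzy nyz].
    have := split3 y z nzy; rewrite deg (com z y nzy) [e z y]esym (negbTE nyz).
    by move=> /= H; split=> //; lia.
- move=> y z yz; rewrite com ?yz //.
  by apply: contraTneq yz => ->.
Qed.

(** Works on plain natural numbers so that [vm_compute] can decide it without enumerating a finite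
    type. *)
Definition srg_check (A : nat -> nat -> bool) n s :=
  all (fun y => [&& ~~ A y y, count (A y) (iota 0 n) == 2 * s &
    all (fun z => (A y z == A z y) &&
      ((y == z) || (count (fun w => A y w && A z w) (iota 0 n) == if A y z then 1 else s)))
      (iota 0 n)]) (iota 0 n).

Lemma card_ord_pred n (P : pred nat) : #|[set i : 'I_n | P i]| = count P (iota 0 n).
Proof.
by rewrite -sum1dep_card -(big_mkord P (fun=> 1)) sum1_count /index_iota subn0.
Qed.

Lemma srg_check_extensible A n s sbar :
  sbar + 2 = 2 * s -> n = 1 + 2 * s + 2 * sbar -> srg_check A n s ->
  extensible (fun i j : 'I_n => A i j) 1 s sbar.
Proof.
move=> sb nE /allP chk.
have mem (i : 'I_n) : (i : nat) \in iota 0 n by rewrite mem_iota ltn_ord.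
apply: srg_extensible; rewrite ?card_ord //.
- split=> [i|i j]; have /and3P[H1 _ /allP H3] := chk i (mem i); first by [].
  by have /andP[/eqP] := H3 j (mem j).
- move=> i; have /and3P[_ /eqP <- _] := chk i (mem i); exact: card_ord_pred.
- move=> i j nij; have /and3P[_ _ /allP H3] := chk i (mem i).
  have /andP[_] := H3 j (mem j); rewrite -(inj_eq val_inj) in nij.
  rewrite (negbTE nij) /= => /eqP <-; rewrite -card_ord_pred.
  by apply: eq_card => w; rewrite !inE.
Qed.

Definition bit c i := odd (iter i half c).

Definition symp4 c d := (bit c 0 && bit d 1) (+) (bit c 1 && bit d 0) (+)
  (bit c 2 && bit d 3) (+) (bit c 3 && bit d 2).

Definition symp6 c d := symp4 c d (+) (bit c 4 && bit d 5) (+) (bit c 5 && bit d 4).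

Definition quad6 c := (bit c 0 && bit c 1) (+) (bit c 2 && bit c 3) (+) (bit c 4 && bit c 5).

Definition quad6_codes := Eval vm_compute in [seq c <- iota 0 64 | quad6 c].

Definition adj28 c d := (c != d) && ~~ symp6 c d.

Definition code27 i := nth 0 quad6_codes i.+1.

Definition code_apex := nth 0 quad6_codes 0.

Definition adj3 (i j : nat) := i != j.

(** The rook graph of a 3 by 3 board, with quotient and remainder by 3 as row and column. *)
Definition adj9 i j := (i != j) && ((i %/ 3 == j %/ 3) || (i %% 3 == j %% 3)).

(* The nonzero vectors of a symplectic space of dimension 4 over F_2. *)
Definition adj15 i j := (i != j) && ~~ symp4 i.+1 j.+1.

(* The descendant at [code_apex] of the two-graph of [adj28] on the 28 vectors
   with [quad6 c = 1]. *)
Definition adj27 i j :=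
  adj28 (code27 i) (code27 j) (+) adj28 code_apex (code27 i) (+) adj28 code_apex (code27 j).

Lemma adj27_extensible : extensible (fun i j : 'I_27 => adj27 i j) 1 5 8.
Proof. by apply: srg_check_extensible; [| |vm_compute]. Qed.

Lemma exists_extensible (s sbar : nat) :
  (s, sbar) \in [:: (1, 0); (2, 2); (3, 4); (5, 8)] ->
  exists lam : rel 'I_(1 + 2 * s + 2 * sbar), extensible lam 1 s sbar.
Proof.
rewrite !inE => /or4P[] /eqP[-> ->].
- by exists (fun i j : 'I_3 => adj3 i j); apply: srg_check_extensible.
- by exists (fun i j : 'I_9 => adj9 i j); apply: srg_check_extensible; [| |vm_compute].
- by exists (fun i j : 'I_15 => adj15 i j); apply: srg_check_extensible; [| |vm_compute].
- by exists (fun i j : 'I_27 => adj27 i j); apply: adj27_extensible.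
Qed.

(** * Elliptic quadratic forms and Sp(6,2) *)

Definition vec6 (c : nat) : V6 := [ffun i : 'I_6 => bit c i].

Definition quad (v : V6) : bool :=
  (v (o6 0) && v (o6 1)) (+) (v (o6 2) && v (o6 3)) (+) (v (o6 4) && v (o6 5)).

Lemma quad_vec6 c : quad (vec6 c) = quad6 c.
Proof. by rewrite /quad !ffunE !inordK. Qed.

Lemma symp_vec6 c d : symp (vec6 c) (vec6 d) = symp6 c d.
Proof. by rewrite /symp !ffunE !inordK. Qed.

Lemma vec6_inj c d : c < 64 -> d < 64 -> vec6 c = vec6 d -> c = d.
Proof.
move=> c64 d64 E.
have chk : all (fun c => all (fun d =>
    all (fun i => bit c i == bit d i) (iota 0 6) ==> (c == d)) (iota 0 64)) (iota 0 64).
  by vm_compute.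
have := allP (allP chk c _) d; rewrite !mem_iota c64 d64 => /(_ isT isT)/implyP H.
apply/eqP/H/allP => i; rewrite mem_iota => /andP[_ i6].
by have := congr1 (fun v : V6 => v (Ordinal i6)) E; rewrite !ffunE => /= ->.
Qed.

Lemma vec6_bij : bijective (fun c : 'I_64 => vec6 c).
Proof.
apply: inj_card_bij => [c d /vec6_inj H|]; first by apply: val_inj; apply: H.
by rewrite card_ffun card_bool !card_ord.
Qed.

Lemma vec6_surj v : exists2 c, c < 64 & v = vec6 c.
Proof.
by case: vec6_bij => g _ gK; exists (g v); rewrite ?ltn_ord // gK.
Qed.

Lemma card_quad : #|[set v | quad v]| = 28.
Proof.
have -> : [set v | quad v] = [set vec6 c | c : 'I_64 in [set c : 'I_64 | quad6 c]].
  apply/setP => v; rewrite inE; apply/idP/imsetP => [qv|[c]]; last first.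
    by rewrite inE -quad_vec6 => qc ->.
  by have [c c64 E] := vec6_surj v; exists (Ordinal c64); rewrite // inE -quad_vec6 -E.
rewrite card_imset; last exact: (bij_inj vec6_bij).
by rewrite card_ord_pred; vm_compute.
Qed.

Lemma symp_nondeg u v : (forall w, symp u w = symp v w) -> u = v.
Proof.
have [c c64 ->] := vec6_surj u; have [d d64 ->] := vec6_surj v => H.
(* The powers of two code the six basis vectors, which suffice as tests. *)
have chk : all (fun c => all (fun d =>
    all (fun w => symp6 c w == symp6 d w) [:: 1; 2; 4; 8; 16; 32] ==> (c == d))
    (iota 0 64)) (iota 0 64) by vm_compute.
have := allP (allP chk c _) d; rewrite !mem_iota c64 d64 => /(_ isT isT)/implyP H'.
congr vec6; apply/eqP/H'/allP => w _; by rewrite -!symp_vec6 H.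
Qed.

Definition hyp a b c d := (a && d) (+) (b && c).

Lemma sympE u v : symp u v =
  hyp (u (o6 0)) (u (o6 1)) (v (o6 0)) (v (o6 1)) (+)
  hyp (u (o6 2)) (u (o6 3)) (v (o6 2)) (v (o6 3)) (+)
  hyp (u (o6 4)) (u (o6 5)) (v (o6 4)) (v (o6 5)).
Proof. by rewrite /symp /hyp !addbA. Qed.

Lemma hypDl a b a' b' c d : hyp (a (+) a') (b (+) b') c d = hyp a b c d (+) hyp a' b' c d.
Proof. by case: a; case: b; case: a'; case: b'; case: c; case: d. Qed.

Lemma hypC a b c d : hyp a b c d = hyp c d a b.
Proof. by case: a; case: b; case: c; case: d. Qed.

Lemma andb_hyp a b a' b' :
  (a (+) a') && (b (+) b') = (a && b) (+) (a' && b') (+) hyp a b a' b'.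
Proof. by case: a; case: b; case: a'; case: b'. Qed.

Lemma sympC u v : symp u v = symp v u.
Proof. by rewrite !sympE; congr (_ (+) _ (+) _); apply: hypC. Qed.

Lemma symp_vv u : symp u u = false.
Proof. by rewrite !sympE /hyp ![u (o6 0) && _]andbC ![u (o6 2) && _]andbC ![u (o6 4) && _]andbC !addbb. Qed.

Lemma addb3ACA a b c a' b' c' :
  (a (+) a') (+) (b (+) b') (+) (c (+) c') = (a (+) b (+) c) (+) (a' (+) b' (+) c').
Proof. by rewrite (addbACA a) addbACA. Qed.

Lemma sympDl u v w : symp (vadd u v) w = symp u w (+) symp v w.
Proof. by rewrite !sympE !ffunE !hypDl addb3ACA. Qed.

Lemma sympDr u v w : symp w (vadd u v) = symp w u (+) symp w v.
Proof. by rewrite sympC sympDl ![symp _ w]sympC. Qed.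

Lemma quadD u v : quad (vadd u v) = quad u (+) quad v (+) symp u v.
Proof.
by rewrite /quad sympE !ffunE !andb_hyp addb3ACA (addb3ACA (u _ && _)).
Qed.

Lemma vaddC u v : vadd u v = vadd v u.
Proof. by apply/ffunP => i; rewrite !ffunE addbC. Qed.

Lemma vaddK u v : vadd (vadd u v) v = u.
Proof. by apply/ffunP => i; rewrite !ffunE -addbA addbb addbF. Qed.

Lemma vadd_sum u v w : vadd (vadd w u) (vadd w v) = vadd u v.
Proof. by apply/ffunP => i; rewrite !ffunE addbACA addbb addFb. Qed.

Lemma quad_decomp u : exists q r, [/\ quad q, quad r & vadd q r = u].
Proof.
have [c c64 ->] := vec6_surj u.
(* For [quad d] true, the sum of [c] and [d] satisfies [quad] exactly when [quad c] equals the
   symplectic product of [d] and [c]; such a [d] is found by search. *)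
have chk : all (fun c => has (fun d => quad6 d && (quad6 c == symp6 d c)) (iota 0 64)) (iota 0 64).
  by vm_compute.
have := allP chk c; rewrite mem_iota => /(_ c64)/hasP[d _ /andP[qd /eqP E]].
exists (vec6 d), (vadd (vec6 c) (vec6 d)); split.
- by rewrite quad_vec6.
- by rewrite quadD !quad_vec6 sympC symp_vec6 E qd; case: (symp6 d c).
- by rewrite vaddC vaddK.
Qed.

Definition qform (p : V6) : {ffun V6 -> bool} := [ffun v => quad v (+) symp p v].

Lemma qformD p u v : qform p (vadd u v) = qform p u (+) qform p v (+) symp u v.
Proof.
rewrite !ffunE quadD sympDr; move: (quad u) (quad v) (symp u v) (symp p u) (symp p v).
by do 5 case.
Qed.

Lemma qform_inj : injective qform.
Proof.
move=> p q /ffunP H; apply: symp_nondeg => w.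
by have := H w; rewrite !ffunE => /addbI.
Qed.

Lemma qform_add p q v : symp (vadd p q) v = qform p v (+) qform q v.
Proof. by rewrite sympDl !ffunE; case: (quad v); case: (symp p v); case: (symp q v). Qed.

Lemma qform_self p q : qform p (vadd p q) = quad p (+) quad q.
Proof.
rewrite !ffunE quadD sympDr symp_vv; move: (quad p) (quad q) (symp p q).
by do 3 case.
Qed.

(** Up to the constant [quad p], this form is [quad] translated by [p]. It is thus true on 28
    vectors when [quad p] fails, and on the complementary 36 when it holds. *)
Lemma minus_qform p : minus_form (qform p) = quad p.
Proof.
rewrite /minus_form; have -> /= : [forall u, forall v,
    qform p (vadd u v) == qform p u (+) qform p v (+) symp u v].
  by apply/forallP => u; apply/forallP => v; rewrite qformD.
have vI : injective (vadd p) by move=> u v; rewrite ![vadd p _]vaddC => /(congr1 (vadd^~ p)); rewrite !vaddK.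
have E v : qform p v = quad (vadd p v) (+) quad p.
  by rewrite quadD ffunE; case: (quad p); case: (quad v); case: (symp p v).
case: (boolP (quad p)) => qp.
  have -> : [set v | qform p v] = vadd p @^-1: ~: [set v | quad v].
    by apply/setP => v; rewrite !inE E qp addbT.
  rewrite on_card_preimset; last by exists (vadd p) => v _; rewrite ![vadd p _]vaddC vaddK.
  have := cardsC [set v | quad v]; rewrite card_quad card_ffun card_bool card_ord.
  by move=> /(canRL (addKn _)) ->.
have -> : [set v | qform p v] = vadd p @^-1: [set v | quad v].
  by apply/setP => v; rewrite !inE E (negbTE qp) addbF.
rewrite on_card_preimset ?card_quad //.
by exists (vadd p) => v _; rewrite ![vadd p _]vaddC vaddK.
Qed.

Lemma o6_eq i j : i < 6 -> j < 6 -> (o6 i == o6 j) = (i == j).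
Proof. by move=> i6 j6; rewrite -val_eqE /= !inordK. Qed.

Lemma ord6_ind (P : 'I_6 -> Prop) :
  P (o6 0) -> P (o6 1) -> P (o6 2) -> P (o6 3) -> P (o6 4) -> P (o6 5) -> forall i, P i.
Proof.
move=> P0 P1 P2 P3 P4 P5 i.
have -> : i = o6 i by rewrite /o6 inord_val.
by case: i => -[|[|[|[|[|[|]]]]]].
Qed.

Definition scal6 b k : V6 := [ffun i => b && (i == o6 k)].

Lemma vec_basis (v : V6) :
  v = vadd (vadd (vadd (vadd (vadd (scal6 (v (o6 0)) 0) (scal6 (v (o6 1)) 1))
        (scal6 (v (o6 2)) 2)) (scal6 (v (o6 3)) 3)) (scal6 (v (o6 4)) 4)) (scal6 (v (o6 5)) 5).
Proof.
by apply/ffunP; apply: ord6_ind; rewrite !ffunE !o6_eq // !andbF !andbT ?addbF ?addFb.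
Qed.

Lemma additive_symp (L : V6 -> bool) :
  (forall u v, L (vadd u v) = L u (+) L v) -> exists p, forall v, L v = symp p v.
Proof.
move=> LD.
have L0 k : L (scal6 false k) = false.
  rewrite -[RHS](addbb (L (scal6 false k))) -LD.
  by congr (L _); apply/ffunP => i; rewrite !ffunE.
have [x Lb] : exists x, forall b k, L (scal6 b k) = x k && b.
  by exists (fun k => L (scal6 true k)) => -[] k; rewrite ?andbT // L0 andbF.
(* Coordinates are exchanged in pairs because [symp] pairs 0 with 1, 2 with 3 and 4 with 5. *)
exists [ffun i : 'I_6 => nth false [:: x 1; x 0; x 3; x 2; x 5; x 4] i] => v.
rewrite {1}(vec_basis v) !LD !Lb /symp !ffunE !inordK //=.
move: (x 0) (x 1) (x 2) (x 3) (x 4) (x 5) => x0 x1 x2 x3 x4 x5.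
have H a b c d f g : a (+) b (+) c (+) d (+) f (+) g = b (+) a (+) d (+) c (+) g (+) f.
  by rewrite [a (+) b]addbC (addbAC _ c) (addbAC _ f).
exact: H.
Qed.

(** [Q] and [quad] have the same polarization, so their sum is additive and hence of the form
    [symp p]. *)
Lemma minus_form_qform Q : minus_form Q -> exists2 p, quad p & Q = qform p.
Proof.
move=> mQ; have /andP[/forallP H _] := mQ.
have QD u v : Q (vadd u v) = Q u (+) Q v (+) symp u v by have /forallP/(_ v)/eqP := H u.
have [p Hp] : exists p, forall v, Q v (+) quad v = symp p v.
  apply: additive_symp => u v; rewrite QD quadD.
  move: (Q u) (Q v) (quad u) (quad v) (symp u v); by do 5 case.
have E : Q = qform p.
  by apply/ffunP => v; rewrite !ffunE -Hp; case: (Q v); case: (quad v).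
by exists p; rewrite // -minus_qform -E.
Qed.

Lemma Sp62P (g : {perm V6}) : reflect
  ((forall u v, g (vadd u v) = vadd (g u) (g v)) /\ forall u v, symp (g u) (g v) = symp u v)
  (g \in Sp62).
Proof.
rewrite inE; apply: (iffP forallP) => [H|[H1 H2] u].
  by split=> u v; have /forallP/(_ v)/andP[/eqP E1 /eqP E2] := H u.
by apply/forallP => v; rewrite H1 H2 !eqxx.
Qed.

(** * Permutations of the 28 vectors and symplectic maps *)

Section Sp62Action.
Variables (X : finType) (f : X -> V6).
Hypotheses (fI : injective f) (fq : forall x, quad (f x)).
Hypothesis (fS : forall q, quad q -> exists x, f x = q).

Definition tri_symp i j k := symp (f i) (f j) (+) symp (f j) (f k) (+) symp (f i) (f k).

Definition form_of (x : X) : Omega28 :=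
  Sub (qform (f x)) (etrans (minus_qform (f x)) (fq x)).

Lemma form_of_bij : bijective form_of.
Proof.
have I : injective form_of.
  by move=> x y /(congr1 val)/qform_inj/fI.
apply: inj_card_bij => //.
rewrite -(card_imset _ I) -[X in X <= _]cardsT; apply/subset_leq_card/subsetP => Q _.
have [p qp E] := minus_form_qform (valP Q); have [x Ex] := fS qp.
by apply/imsetP; exists x => //; apply: val_inj; rewrite /= Ex.
Qed.

Lemma tri_sympE i j k : tri_symp i j k = symp (vadd (f i) (f j)) (vadd (f i) (f k)).
Proof.
rewrite /tri_symp sympDl !sympDr symp_vv [symp (f j) (f i)]sympC.
by case: (symp (f i) (f j)); case: (symp (f j) (f k)); case: (symp (f i) (f k)).
Qed.

Lemma symp_diff_tri i j k l :
  symp (vadd (f i) (f j)) (vadd (f k) (f l)) = tri_symp i j k (+) tri_symp i j l.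
Proof.
rewrite /tri_symp sympDl !sympDr.
move: (symp (f i) (f j)) (symp (f i) (f k)) (symp (f i) (f l)) (symp (f j) (f k))
  (symp (f j) (f l)).
by do 5 case.
Qed.

Lemma tri_symp_Sp62 (p : {perm X}) :
  (forall i j k, tri_symp (p i) (p j) (p k) = tri_symp i j k) ->
  exists2 g, g \in Sp62 & forall x, qform (f (p x)) = form_act g (qform (f x)).
Proof.
move=> pt.
have pd i j k l : symp (vadd (f (p i)) (f (p j))) (vadd (f (p k)) (f (p l))) =
                  symp (vadd (f i) (f j)) (vadd (f k) (f l)).
  by rewrite !symp_diff_tri !pt.
have dec u : exists i j, vadd (f i) (f j) = u.
  have [q [r [/fS[i <-] /fS[j <-] <-]]] := quad_decomp u; by exists i, j.
have decp u : exists i j, vadd (f (p i)) (f (p j)) = u.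
  have [i [j E]] := dec u; exists (p^-1%g i), (p^-1%g j); by rewrite !permKV.
have [x0 _] := dec [ffun=> false].
(* Every vector is a sum of two values of [f]. A choice is made here; [gE] below shows by
   nondegeneracy that [g] does not depend on it. *)
pose rep u := odflt (x0, x0) [pick d : X * X | vadd (f d.1) (f d.2) == u].
have repE u : vadd (f (rep u).1) (f (rep u).2) = u.
  rewrite /rep; case: pickP => [d /eqP //|H]; have [i [j E]] := dec u.
  by have := H (i, j); rewrite /= E eqxx.
pose g u := vadd (f (p (rep u).1)) (f (p (rep u).2)).
have gd u i j : symp (g u) (vadd (f (p i)) (f (p j))) = symp u (vadd (f i) (f j)).
  by rewrite pd repE.
have gE i j : g (vadd (f i) (f j)) = vadd (f (p i)) (f (p j)).
  by apply: symp_nondeg => w; have [k [l <-]] := decp w; rewrite gd pd.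
have gs u v : symp (g u) (g v) = symp u v by rewrite {2}/g gd repE.
have gI : injective g.
  by move=> u v E; apply: symp_nondeg => w; rewrite -gs E gs.
have gD u v : g (vadd u v) = vadd (g u) (g v).
  apply: symp_nondeg => w; have [k [l <-]] := decp w.
  by rewrite sympDl !gd sympDl.
exists (perm gI).
  by apply/Sp62P; split=> u v; rewrite !permE.
move=> x; apply/ffunP => v; rewrite [RHS]ffunE.
set u := (perm gI)^-1%g v; have -> : v = g u by rewrite -(permE gI) permKV.
have [i [j <-]] := dec u.
(* Each form vanishes on the sum of its own vector with any other of the 28, so after inserting
   [f x] twice only the symplectic term is left, and [pd] preserves it. *)
rewrite gE -(vadd_sum (f i) (f j) (f x)) -(vadd_sum (f (p i)) (f (p j)) (f (p x))).
by rewrite !(qformD _ (vadd _ _)) !qform_self !fq pd.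
Qed.

Lemma Sp62_tri_symp (p : {perm X}) g : g \in Sp62 ->
  (forall x, qform (f (p x)) = form_act g (qform (f x))) ->
  forall i j k, tri_symp (p i) (p j) (p k) = tri_symp i j k.
Proof.
move=> /Sp62P[_ gs] pg i j k.
have H x z : vadd (f (p x)) (f (p z)) = g (vadd (f x) (f z)).
  apply: symp_nondeg => w; rewrite -(permKV g w) gs !qform_add !pg.
  by rewrite /form_act !ffunE permK.
by rewrite !tri_sympE !H gs.
Qed.

Lemma perm_iso_Sp62 (A : {set {perm X}}) :
  (forall p, p \in A <-> forall i j k, tri_symp (p i) (p j) (p k) = tri_symp i j k) ->
  perm_iso A Sp62_on28.
Proof.
move=> AE; have [h hK Kh] := form_of_bij.
exists form_of; split; first exact: form_of_bij.
- move=> p /AE/tri_symp_Sp62[g gS gE].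
  have I : injective (fun Q => form_of (p (h Q))).
    by move=> Q R /(can_inj hK)/perm_inj/(can_inj Kh).
  exists (perm I) => [|x]; last by rewrite permE hK.
  rewrite inE; apply/existsP; exists g; rewrite gS; apply/forallP => Q.
  by rewrite permE /= gE -{2}(Kh Q).
- move=> t; rewrite inE => /existsP[g /andP[gS /forallP gE]].
  have I : injective (fun x => h (t (form_of x))).
    by move=> x z /(can_inj Kh)/perm_inj/(can_inj hK).
  exists (perm I) => [|x]; last by rewrite permE Kh.
  apply/AE; apply: (Sp62_tri_symp gS) => x; rewrite permE.
  by have /eqP <- := gE (form_of x); rewrite -{2}(Kh (t (form_of x))).
Qed.

End Sp62Action.

(** * Classification *)

Section Classification.
Variables (T : finType) (e : rel T) (s sbar : nat).
Hypothesis ext : extensible e 1 s sbar.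

Lemma ext_params : (s, sbar) \in [:: (1, 0); (2, 2); (3, 4); (5, 8)].
Proof.
have sb := ext_sbar ext.
have [s1|s1] := leqP s 1.
  have -> : s = 1 by lia.
  by have -> : sbar = 0 by lia.
have [y _] := ext_nonempty ext; have [z Dz] := exists_dist2 ext y s1.
have [a fr] := exists_frame ext Dz.
move: (frame_params ext fr); rewrite !inE => /or3P[] /eqP sE; rewrite sE in sb *.
- by have -> : sbar = 2 by lia.
- by have -> : sbar = 4 by lia.
- by have -> : sbar = 8 by lia.
Qed.

Lemma ext1_complete : s = 1 -> forall a b, e a b = (a != b).
Proof.
move=> s1 a b; have cT := ext_card ext; rewrite s1 in cT.
have : nbhd e a = ~: [set a].
  apply/eqP; rewrite eqEcard (ext_card_nbhd ext) cardsC1; apply/andP; split; last by lia.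
  by apply/subsetP => u; rewrite !inE => /(ext_adj_neq ext); rewrite eq_sym.
by move/setP/(_ b); rewrite !inE eq_sym.
Qed.

End Classification.

Lemma extensible_unique (T1 T2 : finType) (e1 : rel T1) (e2 : rel T2) s sbar :
  extensible e1 1 s sbar -> extensible e2 1 s sbar -> graph_iso e1 e2.
Proof.
move=> ext1 ext2; have sb := ext_sbar ext1.
have [s1|s1] := leqP s 1.
  have E : s = 1 by lia.
  have cT : #|T1| = #|T2| by have := ext_card ext1; have := ext_card ext2; lia.
  pose f x : T2 := enum_val (cast_ord cT (enum_rank x)).
  have fI : injective f by move=> u w /enum_val_inj/cast_ord_inj/enum_rank_inj.
  exists f; split; first by apply: inj_card_bij; rewrite ?cT.
  by move=> a b; rewrite !(ext1_complete ext1, ext1_complete ext2) // (inj_eq fI).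
have [y1 _] := ext_nonempty ext1; have [z1 D1] := exists_dist2 ext1 y1 s1.
have [y2 _] := ext_nonempty ext2; have [z2 D2] := exists_dist2 ext2 y2 s1.
have [a1 fr1] := exists_frame ext1 D1; have [a2 fr2] := exists_frame ext2 D2.
by have [f [fB fE _ _ _]] := frame_iso ext1 ext2 fr1 fr2; exists f.
Qed.

(** * Cubes as graphs at distance 2 *)

Lemma hamming1E n (u w : {ffun 'I_n -> bool}) :
  (hamming u w == 1) = [exists i, vadd2 u (unitv i) == w].
Proof.
apply/cards1P/existsP => -[i H]; exists i.
  apply/eqP/ffunP => j; move/setP/(_ j): H; rewrite !ffunE !inE [i == j]eq_sym => <-.
  by case: (u j); case: (w j).
apply/setP => j; rewrite -(eqP H) !inE !ffunE [j == i]eq_sym.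
by case: (u j); case: (i == j).
Qed.

Lemma hamming_max n (u w : {ffun 'I_n -> bool}) : (hamming u w == n) = (vadd2 u (ones n) == w).
Proof.
have -> : (hamming u w == n) = ([set i | u i != w i] == setT).
  rewrite eqEcard subsetT cardsT card_ord eqn_leq; apply: andb_idl => _.
  by rewrite -[X in _ <= X]card_ord max_card.
apply/eqP/eqP => [/setP H|<-].
  apply/ffunP => i; rewrite !ffunE; have := H i; rewrite !inE.
  by case: (u i); case: (w i).
by apply/setP => i; rewrite !inE !ffunE; case: (u i).
Qed.

Lemma dist2_cube_iso (T : finType) (e : rel T) (s sbar : nat) (y : T) :
  extensible e 1 s sbar -> s = 2 \/ s = 3 ->
  perm_iso (graphAut (induced e (dist2 e y))) (graphAut (cube_graph s)).
Proof.
move=> ext s23; have s1 : 1 < s by case: s23 => ->.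
have n5 : (s == 5) = false by case: s23 => ->.
have eqvE (v w : {ffun 'I_s -> bool}) : eqv v w = (v == w) by rewrite /eqv n5 orbF.
have [|||f [fB fE]] := @slides_graph_iso T e s sbar ext y s1 _ (cube_graph s) id.
- by rewrite card_ffun card_bool card_ord; case: s23 => ->.
- by move=> u w; rewrite eqvE => /eqP.
- by move=> u w; rewrite /cube_graph hamming1E; apply: eq_existsb => i; rewrite eqvE.
exact: perm_iso_graphAut fB fE.
Qed.

Definition extend0 (u : {ffun 'I_4 -> bool}) : {ffun 'I_5 -> bool} :=
  [ffun i => if unlift ord_max i is Some j then u j else false].

Lemma extend0_lift u j : extend0 u (lift ord_max j) = u j.
Proof. by rewrite ffunE liftK. Qed.

Lemma extend0_inj : injective extend0.
Proof. by move=> u w /ffunP H; apply/ffunP => j; rewrite -!extend0_lift. Qed.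

Lemma extend0_unit u j : vadd2 (extend0 u) (unitv (lift ord_max j)) = extend0 (vadd2 u (unitv j)).
Proof.
apply/ffunP => i; rewrite !ffunE; case: unliftP => [k ->|->]; rewrite ?ffunE.
  by rewrite (inj_eq (@lift_inj _ _)).
by rewrite eq_sym (negbTE (neq_lift _ _)).
Qed.

Lemma extend0_ones u :
  vadd2 (vadd2 (extend0 u) (unitv ord_max)) (ones 5) = extend0 (vadd2 u (ones 4)).
Proof.
apply/ffunP => i; rewrite !ffunE; case: unliftP => [k ->|->]; rewrite ?ffunE ?eqxx //.
by rewrite (negbTE (neq_lift _ _)) addbF.
Qed.

(** Vectors with last coordinate 0 represent F_2^5 modulo [ones]. The last unit vector is congruent
    to the all-one vector on the first four coordinates, and so yields the main diagonals. *)
Lemma cube4_diagE u w :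
  cube4_diag u w = [exists i, eqv (vadd2 (extend0 u) (unitv i)) (extend0 w)].
Proof.
rewrite /cube4_diag hamming1E hamming_max; apply/orP/existsP.
  case=> [/existsP[j /eqP <-]|/eqP <-].
    by exists (lift ord_max j); apply/orP; left; rewrite extend0_unit.
  by exists ord_max; apply/orP; right; rewrite extend0_ones !eqxx.
case=> i; case: (unliftP ord_max i) => [j ->|->] /orP[/eqP E|/andP[_ /eqP E]].
- by left; apply/existsP; exists j; rewrite -(inj_eq extend0_inj) -extend0_unit E.
- by move/ffunP/(_ ord_max): E; rewrite extend0_unit !ffunE unlift_none.
- by move/ffunP/(_ ord_max): E; rewrite !ffunE unlift_none eqxx.
- by right; rewrite -(inj_eq extend0_inj) -extend0_ones E.
Qed.

Lemma dist2_cube4_iso (T : finType) (e : rel T) (y : T) :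
  extensible e 1 5 8 ->
  perm_iso (graphAut (induced e (dist2 e y))) (graphAut cube4_diag).
Proof.
move=> ext.
have [|||f [fB fE]] := @slides_graph_iso T e 5 8 ext y isT _ cube4_diag extend0.
- by rewrite card_ffun card_bool card_ord.
- move=> u w /orP[/eqP/extend0_inj //|/andP[_ /eqP/ffunP/(_ ord_max)]].
  by rewrite !ffunE unlift_none.
- exact: cube4_diagE.
exact: perm_iso_graphAut fB fE.
Qed.

Lemma cone_perm_iso_Sp62 (T : finType) (e : rel T) :
  extensible e 1 5 8 -> perm_iso (Ggrp (cone e)) Sp62_on28.
Proof.
move=> ext.
have [phi [phiB phiE]] := extensible_unique ext adj27_extensible.
(* The apex takes the first of the 28 codes, matching the shift by one in [code27]. *)
pose idx (x : option T) : nat := if x is Some t then (phi t).+1 else 0.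
have idx28 x : idx x < 28 by case: x => [t|] //=; rewrite ltnS ltn_ord.
have idxI : injective idx.
  by move=> [t|] [u|] //= [/val_inj/(bij_inj phiB) ->].
pose code x := nth 0 quad6_codes (idx x).
have codes_filter : quad6_codes = [seq c <- iota 0 64 | quad6 c] by vm_compute.
have codeP x : quad6 (code x) && (code x < 64).
  have : code x \in quad6_codes by apply: mem_nth.
  by rewrite codes_filter mem_filter mem_iota.
have codeI : injective code.
  have uc : uniq quad6_codes by rewrite codes_filter filter_uniq ?iota_uniq.
  by move=> x z /eqP; rewrite nth_uniq // => /eqP/idxI.
pose f x := vec6 (code x).
have fI : injective f.
  by move=> x z /vec6_inj H; apply: codeI; apply: H; [have /andP[] := codeP x | have /andP[] := codeP z].
have fq x : quad (f x) by rewrite quad_vec6; have /andP[] := codeP x.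
have fS q : quad q -> exists x, f x = q.
  have [c c64 ->] := vec6_surj q; rewrite quad_vec6 => qc.
  have cin : c \in quad6_codes by rewrite codes_filter mem_filter qc mem_iota.
  have := nth_index 0 cin; have : index c quad6_codes < 28 by rewrite index_mem.
  case: (index c quad6_codes) => [|k] k28 E.
    by exists None; apply: (congr1 vec6 E).
  have [psi _ psiK] := phiB.
  exists (Some (psi (Ordinal (k28 : k < 27)))).
  by rewrite -E /f /code /idx psiK.
pose a i j := (i != j) && ~~ symp (f i) (f j).
have aE i j : a i j = adj28 (code i) (code j).
  by rewrite /a /adj28 (inj_eq codeI) symp_vec6.
have aC i j : a i j = a j i by rewrite /a eq_sym sympC.
have aa i : a i i = false by rewrite /a eqxx.
have adjE i j : adjb (cone e) i j = a i j (+) a None i (+) a None j.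
  case: i j => [i|] [j|].
  - by rewrite (adjb_cone ext) !aE -phiE.
  - by rewrite (adjb_coneC ext) adjb_coneN aC aa addbb.
  - by rewrite adjb_coneN aa addbF addbb.
  - by rewrite adjb_coneN !aa.
(* The row of [None] cancels in the triple sum, so [tri] may be computed with [a]. On distinct
   points it has three complemented terms, an odd number, hence the negation; both invariants vanish
   on degenerate triples. *)
have triE i j k :
    tri (cone e) i j k = [&& i != j, j != k & i != k] && ~~ tri_symp f i j k.
  have -> : tri (cone e) i j k = a i j (+) a j k (+) a i k.
    rewrite /tri !adjE; move: (a i j) (a j k) (a i k) (a None i) (a None j) (a None k).
    by do 6 case.
  have [<-|nij] := eqVneq i j; first by rewrite aa addbb.
  have [<-|njk] := eqVneq j k; first by rewrite aa addbF addbb.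
  have [<-|nik] := eqVneq i k; first by rewrite aa [a j i]aC addbb.
  rewrite /a nij njk nik /tri_symp /=.
  by case: (symp (f i) (f j)); case: (symp (f j) (f k)); case: (symp (f i) (f k)).
have triE' i j k :
    tri_symp f i j k = [&& i != j, j != k & i != k] && ~~ tri (cone e) i j k.
  rewrite triE; case: (boolP [&& _, _ & _]) => /=; first by rewrite negbK.
  rewrite /tri_symp !negb_and !negbK => /or3P[] /eqP <-; rewrite ?symp_vv ?addbb //.
    by rewrite addbF addbb.
  by rewrite [symp (f j) _]sympC addbb.
apply: (perm_iso_Sp62 fI fq fS) => p.
have nE i j : (p i != p j) = (i != j) by rewrite (inj_eq perm_inj).
split=> [/(GgrpP None) pG i j k|pG]; first by rewrite !triE' pG !nE.
by apply/(GgrpP None) => i j k; rewrite !triE pG !nE.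
Qed.

Lemma order_28 : 28 * (432 * 120) = 1451520.
Proof.
(* Keeps the literal in Horner form: its unary normal form overflows the stack. *)
cbn [Nat.of_num_uint Nat.of_uint Nat.of_uint_acc].
by rewrite !PeanoNat.Nat.tail_mul_spec; lia.
Qed.

Lemma order_27 : 432 * 120 = 51840.
Proof.
cbn [Nat.of_num_uint Nat.of_uint Nat.of_uint_acc].
by rewrite !PeanoNat.Nat.tail_mul_spec; lia.
Qed.

Theorem theorem3 :
  (* Part 1: classification of extensible graphs with t = 1 *)
  (forall (T : finType) (lam : rel T) (s sbar : nat),
     extensible lam 1 s sbar ->
     (s, sbar) \in [:: (1, 0); (2, 2); (3, 4); (5, 8)]) /\
  (forall s sbar : nat, (s, sbar) \in [:: (1, 0); (2, 2); (3, 4); (5, 8)] ->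
     exists lam : rel 'I_(1 + 2 * s + 2 * sbar), extensible lam 1 s sbar) /\
  (forall (T1 T2 : finType) (lam1 : rel T1) (lam2 : rel T2) (s sbar : nat),
     extensible lam1 1 s sbar -> extensible lam2 1 s sbar ->
     graph_iso lam1 lam2) /\
  (* Part 2 *)
  (forall (T : finType) (lam : rel T) (s sbar : nat)
          (gam : rel (option T)) (y : T),
     extensible lam 1 s sbar -> simple_graph gam -> Gamma_x_is gam lam ->
     let Y2 := dist2 lam y in
     let lam2 := induced lam Y2 in
     [/\
      (* (a) *)
      (s, sbar) = (1, 0) ->
        [/\ #|T| = 3, #|{: option T}| = 4,
            (forall a b : T, lam a b = (a != b)),
            graphAut lam \isog [set: 'S_3] &
            group_set (Ggrp gam) /\ Ggrp gam \isog [set: 'S_4]],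
      (* (b) *)
      (s, sbar) = (2, 2) ->
        [/\ #|T| = 9, #|{: option T}| = 10,
            perm_iso (graphAut lam2) (graphAut (cube_graph 2)) /\ #|graphAut lam2| = 8,
            transitive_on (graphAut lam) /\ #|graphAut lam| = 72 &
            doubly_transitive (Ggrp gam) /\ #|Ggrp gam| = 720],
      (* (c) *)
      (s, sbar) = (3, 4) ->
        [/\ #|T| = 15, #|{: option T}| = 16,
            perm_iso (graphAut lam2) (graphAut (cube_graph 3)) /\ #|graphAut lam2| = 48,
            transitive_on (graphAut lam) /\ #|graphAut lam| = 720 &
            doubly_transitive (Ggrp gam) /\ #|Ggrp gam| = 11520] &
      (* (d) *)
      (s, sbar) = (5, 8) ->
        [/\ #|T| = 27, #|{: option T}| = 28,
            perm_iso (graphAut lam2) (graphAut cube4_diag) /\ #|graphAut lam2| = 1920,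
            transitive_on (graphAut lam) /\ #|graphAut lam| = 51840 &
            [/\ doubly_transitive (Ggrp gam), #|Ggrp gam| = 1451520 &
                perm_iso (Ggrp gam) Sp62_on28]]]).
Proof.
split; [exact: ext_params | split; first exact: exists_extensible].
split; first exact: extensible_unique.
move=> T lam s sbar gam y ext sgam Ggam Y2 lam2.
rewrite (Ggrp_cone sgam Ggam) {gam sgam Ggam}.
have cT := ext_card ext.
have cA := card_graphAut ext; have cA2 := card_graphAut_dist2 ext y.
have tr := graphAut_transitive ext.
have cG := card_G ext; have dtr s1 := G_doubly_transitive ext (tr s1).
split=> -[sE sbE]; subst s sbar; rewrite card_option.
- have T3 : #|T| = 3 by lia.
  have complete := ext1_complete ext erefl.
  have AT : graphAut lam = setT.
    by apply/setP => p; rewrite [RHS]inE; apply/graphAutP => u w; rewrite !complete (inj_eq perm_inj).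
  have cS (U : finType) : #|[set: {perm U}]| = #|U|`!.
    by rewrite -[#|U|]cardsT -card_perm; apply: eq_card => p; rewrite !inE; apply/esym/subsetP.
  (* By [card_G] the order is [4 * 3!], that of the full symmetric group. *)
  have GT : Ggrp (cone lam) = setT.
    by apply/eqP; rewrite eqEcard subsetT cG AT !cS card_option T3.
  split=> //; first by rewrite T3.
    by apply: isog_perm; rewrite ?card_ord.
  split; first exact: (Ggrp_group_set None).
  by apply: isog_perm; rewrite ?card_option ?card_ord ?T3.
- have T9 : #|T| = 9 by lia.
  have A72 : #|graphAut lam| = 72 by rewrite cA // T9.
  split; rewrite ?T9 //.
  + by split; [apply: dist2_cube_iso ext _; left | rewrite cA2].
  + by split; [apply: tr | ].
  + by split; [apply: dtr | rewrite cG A72 T9].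
- have T15 : #|T| = 15 by lia.
  have A720 : #|graphAut lam| = 720 by rewrite cA // T15.
  split; rewrite ?T15 //.
  + by split; [apply: dist2_cube_iso ext _; right | rewrite cA2].
  + by split; [apply: tr | ].
  + by split; [apply: dtr | rewrite cG A720 T15].
- have T27 : #|T| = 27 by lia.
  (* Here 432 is [27 * 16], the number of pairs at distance 2, and 120 is [5!]; the product stays
     unevaluated. *)
  have A : #|graphAut lam| = 432 * 120 by rewrite cA // T27.
  split; rewrite ?T27 //.
  + by split; [apply: dist2_cube4_iso | rewrite cA2].
  + by split; [apply: tr | rewrite A order_27].
  + by split; [apply: dtr | rewrite cG A T27 order_28 | apply: cone_perm_iso_Sp62].
Qed.
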